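(* Let $G$ be a connected, simply connected Lie group endowed with a left-invariant Riemannian metric $g$, and let $(\mathfrak g,\langle\cdot,\cdot\rangle)$ be the corresponding metric Lie algebra. Then $(G,g)$ has reducible holonomy as a Riemannian manifold if and only if there exists a non-trivial orthogonal decomposition $\mathfrak g=\mathfrak g_1\oplus\mathfrak g_2$ such that $\mathfrak g_1$ and $\mathfrak g_2$ are Lie subalgebras of $\mathfrak g$ and $$\langle [x_1,x_2],x_2\rangle=\langle [x_1,x_2],x_1\rangle=0,\qquad \forall x_1\in\mathfrak g_1,\ \forall x_2\in\mathfrak g_2.$$
   Context: The corresponding metric Lie algebra $(\mathfrak g,\langle\cdot,\cdot\rangle)$ is the Lie algebra $\mathfrak g$ of $G$ (left-invariant vector fields) with the inner product determined by $g$. ''Reducible holonomy'' means that the tangent bundle carries a $\nabla^g$-parallel distribution $0\subsetneq D\subsetneq TG$, where $\nabla^g$ is the Levi-Civita connection of $g$. ''Non-trivial'' means that both $\mathfrak g_1$ and $\mathfrak g_2$ are non-zero. *)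

(* Defs.v *)
From HB Require Import structures.
From mathcomp Require Import all_boot all_order all_algebra.
From mathcomp Require Import all_classical all_reals all_analysis.

Set Implicit Arguments.
Unset Strict Implicit.
Unset Printing Implicit Defensive.

Import Order.TTheory GRing.Theory Num.Theory.
Import numFieldNormedType.Exports.

Local Open Scope classical_set_scope.
Local Open Scope ring_scope.

Section SmoothCalculus.
Context {R : realType} {V W : normedModType R}.

(* For finite-dimensional V, f is k.+1 times differentiable iff it is
   differentiable and all the maps 'D_v f are k times differentiable. *)
Fixpoint times_differentiable (k : nat) (U : set V) (f : V -> W) : Prop :=
  if k is k'.+1 then
    (forall x, U x -> differentiable f x) /\
    (forall v, times_differentiable k' U (fun x => 'D_v f x))
  else True.

Definition smooth_on (U : set V) (f : V -> W) : Prop :=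
  forall k, times_differentiable k U f.

End SmoothCalculus.

Section Manifold.
Context {R : realType} (n : nat) (M : topologicalType).

(* chart_map is a homeomorphism from the open set chart_dom onto an open subset
   of R^n, with inverse chart_inv; the values of chart_map off chart_dom, and of
   chart_inv off the image, are irrelevant. *)
Record chart := Chart {
  chart_dom : set M;
  chart_map : M -> 'rV[R]_n;
  chart_inv : 'rV[R]_n -> M;
  chart_dom_open : open chart_dom;
  chart_cod_open : open (chart_map @` chart_dom);
  chart_mapK : forall p, chart_dom p -> chart_inv (chart_map p) = p;
  chart_map_continuous : forall p, chart_dom p ->
    {for p, continuous chart_map};
  chart_inv_continuous : forall y, (chart_map @` chart_dom) y ->
    {for y, continuous chart_inv}
}.

(* The smooth structure is given by an atlas whose charts are indexed by the
   points of M, the chart of index p being defined around p. *)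
Record manifold := Manifold {
  chart_at : M -> chart;
  mem_chart_at : forall p, chart_dom (chart_at p) p;
  chart_compatible : forall p q,
    smooth_on
      (chart_map (chart_at p) @`
         (chart_dom (chart_at p) `&` chart_dom (chart_at q)))
      (chart_map (chart_at q) \o chart_inv (chart_at p));
  manifold_hausdorff : hausdorff_space M;
  manifold_second_countable : @second_countable M
}.

End Manifold.

Arguments chart R n M : clear implicits.
Arguments manifold R n M : clear implicits.

(* A tangent vector at p is represented by its coordinates in the chart of index
   p: every T_p M is 'rV[R]_n, and a (not necessarily smooth) vector field on M
   is a map M -> 'rV[R]_n. *)
Notation vfield R n M := (M -> 'rV[R]_n).

Section TangentCalculus.
Context {R : realType} {n : nat} {M : topologicalType} (A : manifold R n M).
Implicit Types (X Y : vfield R n M) (U : set M).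

Definition tangent_map (f : M -> M) (p : M) (v : 'rV[R]_n) : 'rV[R]_n :=
  'D_v (chart_map (chart_at A (f p)) \o f \o chart_inv (chart_at A p))
       (chart_map (chart_at A p) p).

Definition act {W : normedModType R} X (f : M -> W) : M -> W :=
  fun p =>
    'D_(X p) (f \o chart_inv (chart_at A p)) (chart_map (chart_at A p) p).

Definition smooth_fun_on U (f : M -> R) : Prop :=
  forall q, smooth_on
    (chart_map (chart_at A q) @` (chart_dom (chart_at A q) `&` U))
    (f \o chart_inv (chart_at A q)).

(* act X (chart_map (chart_at A q)) is the vector of components of X in the chart
   of index q. *)
Definition smooth_vfield_on U X : Prop :=
  forall q, smooth_on
    (chart_map (chart_at A q) @` (chart_dom (chart_at A q) `&` U))
    (act X (chart_map (chart_at A q)) \o chart_inv (chart_at A q)).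

Definition smooth_fun := smooth_fun_on setT.
Definition smooth_vfield := smooth_vfield_on setT.

(* The i-th coordinate of [X, Y]_p is X_p (Y x_i) - Y_p (X x_i), with x_i the
   i-th coordinate function of the chart of index p. *)
Definition bracket X Y : vfield R n M := fun p =>
  act X (act Y (chart_map (chart_at A p))) p -
  act Y (act X (chart_map (chart_at A p))) p.

End TangentCalculus.

Section Riemannian.
Context {R : realType} {n : nat} {M : topologicalType} (A : manifold R n M).
Implicit Types (X Y Z : vfield R n M).

Record riemannian_metric := RiemannianMetric {
  metric :> M -> 'rV[R]_n -> 'rV[R]_n -> R;
  riemannian_sym : forall p u v, metric p u v = metric p v u;
  riemannian_linear : forall p a u v w,
    metric p (a *: u + v) w = a * metric p u w + metric p v w;
  riemannian_pos : forall p v, v != 0 -> 0 < metric p v v;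
  riemannian_smooth : forall (U : set M) X Y, open U ->
    smooth_vfield_on A U X -> smooth_vfield_on A U Y ->
    smooth_fun_on A U (fun p => metric p (X p) (Y p))
}.

Implicit Type (nabla : vfield R n M -> vfield R n M -> vfield R n M).

Record is_connection nabla : Prop := IsConnection {
  nabla_smooth : forall X Y, smooth_vfield A X -> smooth_vfield A Y ->
    smooth_vfield A (nabla X Y);
  nablaDl : forall X X' Y, smooth_vfield A X -> smooth_vfield A X' ->
    smooth_vfield A Y -> nabla (X + X') Y = nabla X Y + nabla X' Y;
  nablaZl : forall f X Y, smooth_fun A f -> smooth_vfield A X ->
    smooth_vfield A Y ->
    nabla (fun p => f p *: X p) Y = (fun p => f p *: nabla X Y p);
  nablaDr : forall X Y Y', smooth_vfield A X -> smooth_vfield A Y ->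
    smooth_vfield A Y' -> nabla X (Y + Y') = nabla X Y + nabla X Y';
  nablaZr : forall f X Y, smooth_fun A f -> smooth_vfield A X ->
    smooth_vfield A Y ->
    nabla X (fun p => f p *: Y p) =
      (fun p => act A X f p *: Y p + f p *: nabla X Y p)
}.

Record is_levi_civita (g : riemannian_metric) nabla : Prop := IsLeviCivita {
  levi_civita_connection : is_connection nabla;
  levi_civita_metric : forall X Y Z, smooth_vfield A X -> smooth_vfield A Y ->
    smooth_vfield A Z -> forall p,
    act A X (fun q => g q (Y q) (Z q)) p =
      g p (nabla X Y p) (Z p) + g p (Y p) (nabla X Z p);
  levi_civita_torsion_free : forall X Y, smooth_vfield A X ->
    smooth_vfield A Y -> nabla X Y - nabla Y X = bracket A X Y
}.

(* D is a smooth subbundle of rank k of the tangent bundle. *)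
Definition is_distribution (k : nat) (D : M -> {vspace 'rV[R]_n}) : Prop :=
  forall p, exists (U : set M) (E : 'I_k -> vfield R n M),
    [/\ open U, U p, forall i, smooth_vfield_on A U (E i) &
        forall q, U q -> basis_of (D q) [seq E i q | i <- enum 'I_k]].

Definition is_section (D : M -> {vspace 'rV[R]_n}) X : Prop :=
  forall p, X p \in D p.

Definition parallel nabla (D : M -> {vspace 'rV[R]_n}) : Prop :=
  forall X Y, smooth_vfield A X -> smooth_vfield A Y -> is_section D Y ->
    is_section D (nabla X Y).

Definition reducible_holonomy (g : riemannian_metric) : Prop :=
  exists nabla (k : nat) (D : M -> {vspace 'rV[R]_n}),
    [/\ is_levi_civita g nabla, is_distribution k D, (0 < k < n)%N &
        parallel nabla D].

End Riemannian.

(* Triviality of the fundamental group (at every base point). *)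
Definition simply_connected (R : realType) (M : topologicalType) : Prop :=
  forall gamma : R -> M,
    {within `[0, 1], continuous gamma} -> gamma 0 = gamma 1 ->
    exists H : R * R -> M,
      [/\ {within `[0, 1] `*` `[0, 1], continuous H},
          forall t, 0 <= t <= 1 -> H (0, t) = gamma t,
          forall t, 0 <= t <= 1 -> H (1, t) = gamma 0 &
          forall s, 0 <= s <= 1 -> H (s, 0) = gamma 0 /\ H (s, 1) = gamma 0].

(* A group carrying a topology; the compatibility of the two is part of
   lie_group below. *)
#[short(type="groupTopologicalType")]
HB.structure Definition GroupTopological := {G of Group G & Topological G}.

Record lie_group (R : realType) (n : nat) (G : groupTopologicalType) :=
  LieGroup {
  lie_manifold :> manifold R n G;
  lie_mul_continuous : continuous (fun z : G * G => (z.1 * z.2)%g);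
  lie_mul_smooth : forall a b c : G,
    smooth_on
      [set y : 'rV[R]_n * 'rV[R]_n |
        [/\ (chart_map (chart_at lie_manifold a) @`
               chart_dom (chart_at lie_manifold a)) y.1,
            (chart_map (chart_at lie_manifold b) @`
               chart_dom (chart_at lie_manifold b)) y.2 &
            chart_dom (chart_at lie_manifold c)
              (chart_inv (chart_at lie_manifold a) y.1 *
               chart_inv (chart_at lie_manifold b) y.2)%g]]
      (fun y => chart_map (chart_at lie_manifold c)
                  (chart_inv (chart_at lie_manifold a) y.1 *
                   chart_inv (chart_at lie_manifold b) y.2)%g);
  lie_inv_continuous : continuous (fun x : G => x^-1%g);
  lie_inv_smooth : forall a b : G,
    smooth_on
      (chart_map (chart_at lie_manifold a) @`
         (chart_dom (chart_at lie_manifold a) `&`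
          [set x | chart_dom (chart_at lie_manifold b) x^-1%g]))
      (fun y => chart_map (chart_at lie_manifold b)
                  (chart_inv (chart_at lie_manifold a) y)^-1%g)
}.

Section LieGroup.
Context {R : realType} {n : nat} {G : groupTopologicalType}.
Context (L : lie_group R n G).
Implicit Types (X Y : vfield R n G) (h : set (vfield R n G)).

Definition left_translation (a : G) : G -> G := fun x => (a * x)%g.

Definition left_invariant_metric (g : riemannian_metric L) : Prop :=
  forall a p u v,
    g (left_translation a p) (tangent_map L (left_translation a) p u)
      (tangent_map L (left_translation a) p v) = g p u v.

Definition lie_algebra : set (vfield R n G) :=
  [set X | smooth_vfield L X /\
     forall a p, tangent_map L (left_translation a) p (X p) =
                 X (left_translation a p)].

(* For left-invariant g, X and Y, the function p |-> g p (X p) (Y p) is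
   constant; the inner product of the metric Lie algebra is its value at the
   unit. *)
Definition lie_inner (g : riemannian_metric L) X Y : R := g 1%g (X 1%g) (Y 1%g).

Definition lie_subalgebra h : Prop :=
  [/\ h `<=` lie_algebra, h 0,
      forall (a : R) X Y, h X -> h Y -> h (a *: X + Y) &
      forall X Y, h X -> h Y -> h (bracket L X Y)].

(* Directness of the sum follows from orthogonality. *)
Definition orthogonal_decomposition (g : riemannian_metric L) h1 h2 : Prop :=
  (forall X, lie_algebra X ->
     exists X1 X2, [/\ h1 X1, h2 X2 & X = X1 + X2]) /\
  (forall X1 X2, h1 X1 -> h2 X2 -> lie_inner g X1 X2 = 0).

Definition nonzero h : Prop := exists2 X, h X & X != 0.

End LieGroup.

(* Main.v *)
From HB Require Import structures.
Require Import Defs.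
From mathcomp Require Import all_boot all_order all_algebra.
From mathcomp Require Import all_classical all_reals all_analysis.
From mathcomp Require Import ring lra.

(* Let e be a left-invariant orthonormal frame. In it the Levi-Civita connection
   is given by a linear map Gam from R^n to so(n) through
   nabla_(e x) (e y) = e (y Gam(x)). A subspace W of R^n gives a decomposition as
   in the statement (g1 and g2 consist of the left-invariant fields with
   coordinates in W and in its orthogonal) if and only if it is stable under all
   Gam(x), that is, if the left-invariant distribution spanned by W is parallel.
   It remains to find such a W, given a parallel distribution D.

   At each point D is stable under the span hol of the curvature endomorphisms
   and of their iterated brackets with the Gam(x). Let A be the space of the
   symmetric endomorphisms commuting with hol; the brackets with Gam(x) preserve
   A. By the Bianchi identity R(Sx,y) = R(x,y) S for S in A, which implies that
   the commutators of A annihilate hol.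
   - If the common kernel V0 of hol is zero, A is therefore commutative, and the
     derivation [Gam(x), -] kills the projection onto D: D is left-invariant.
   - If V0 is a nontrivial proper subspace, take W = V0.
   - If V0 is everything, the metric is flat and Gam is a representation. Its
     kernel is stable under all Gam(x). If it is zero, the trace form of Gam is
     an invariant inner product, and by means of its Casimir element one finds
     that the vectors killed by all Gam(x) form a nontrivial proper subspace. *)

Set Implicit Arguments.
Unset Strict Implicit.
Unset Printing Implicit Defensive.

Import Order.TTheory GRing.Theory Num.Theory.
Import numFieldNormedType.Exports.

Local Open Scope classical_set_scope.
Local Open Scope ring_scope.

(** * Linear algebra *)

Section DotProduct.
Context {R : rcfType}.

Definition dot {n} (u v : 'rV[R]_n) : R := (u *m v^T) 0 0.

Lemma dotE n (u v : 'rV[R]_n) : dot u v = \sum_i u 0 i * v 0 i.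
Proof. by rewrite /dot mxE; apply: eq_bigr => i _; rewrite mxE. Qed.

Lemma dotC n (u v : 'rV[R]_n) : dot u v = dot v u.
Proof. by rewrite !dotE; apply: eq_bigr => i _; rewrite mulrC. Qed.

Lemma dotDl n (u v w : 'rV[R]_n) : dot (u + v) w = dot u w + dot v w.
Proof. by rewrite /dot mulmxDl mxE. Qed.

Lemma dotNl n (u w : 'rV[R]_n) : dot (- u) w = - dot u w.
Proof. by rewrite /dot mulNmx mxE. Qed.

Lemma dotZl n a (u w : 'rV[R]_n) : dot (a *: u) w = a * dot u w.
Proof. by rewrite /dot -scalemxAl mxE. Qed.

Lemma dotDr n (u v w : 'rV[R]_n) : dot w (u + v) = dot w u + dot w v.
Proof. by rewrite !(dotC w) dotDl. Qed.

Lemma dotNr n (u w : 'rV[R]_n) : dot w (- u) = - dot w u.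
Proof. by rewrite !(dotC w) dotNl. Qed.

Lemma dotZr n a (u w : 'rV[R]_n) : dot w (a *: u) = a * dot w u.
Proof. by rewrite !(dotC w) dotZl. Qed.

Lemma dot0l n (w : 'rV[R]_n) : dot 0 w = 0.
Proof. by rewrite /dot mul0mx mxE. Qed.

Lemma dot_sumr n (I : finType) (F : I -> 'rV[R]_n) w :
  dot w (\sum_i F i) = \sum_i dot w (F i).
Proof.
elim/big_rec2: _ => [|i y x _ <-]; last by rewrite dotDr.
by rewrite dotC dot0l.
Qed.

Lemma dot_mulmx n (A : 'M[R]_n) (u v : 'rV[R]_n) :
  dot (u *m A) v = dot u (v *m A^T).
Proof. by rewrite /dot trmx_mul trmxK mulmxA. Qed.

Lemma dot_delta n (u : 'rV[R]_n) i : dot u (delta_mx 0 i) = u 0 i.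
Proof. by rewrite /dot trmx_delta -colE mxE. Qed.

Lemma dot_ge0 n (u : 'rV[R]_n) : 0 <= dot u u.
Proof. by rewrite dotE sumr_ge0// => i _; rewrite -expr2 sqr_ge0. Qed.

Lemma dot_eq0 n (u : 'rV[R]_n) : dot u u = 0 -> u = 0.
Proof.
rewrite dotE => /eqP; rewrite psumr_eq0; last first.
  by move=> i _; rewrite -expr2 sqr_ge0.
move=> /allP u0; apply/rowP => i; rewrite mxE; apply/eqP.
by have := u0 i (mem_index_enum i); rewrite /= mulf_eq0 orbb.
Qed.

Lemma dot_inj n (u v : 'rV[R]_n) : (forall w, dot u w = dot v w) -> u = v.
Proof.
move=> uv; apply/eqP; rewrite -subr_eq0; apply/eqP/dot_eq0.
by rewrite dotDl dotNl uv subrr.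
Qed.

(** Induction on the number k of orthonormal rows: while k < n, the matrix [B *m T^T] has rank at
    most k, so some nonzero v is B-orthogonal to all rows of T; once normalised it becomes a new
    first row. *)
Lemma gram_schmidt n (B : 'M[R]_n) : B^T = B ->
  (forall v : 'rV_n, v != 0 -> 0 < (v *m B *m v^T) 0 0) ->
  exists T : 'M[R]_n, T *m B *m T^T = 1%:M.
Proof.
move=> Bsym Bpos.
suff: forall k, (k <= n)%N -> exists T : 'M[R]_(k, n), T *m B *m T^T = 1%:M.
  by apply.
elim=> [_|k IHk ltkn]; first by exists 0; apply/matrixP => -[].
have [T TB] := IHk (ltnW ltkn).
have /rowV0Pn[v /sub_kermxP vT v0] : kermx (B *m T^T) != 0.
  rewrite -mxrank_eq0 mxrank_ker subn_eq0 -ltnNge.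
  by rewrite (leq_ltn_trans (rank_leq_col _)).
set s := (v *m B *m v^T) 0 0; have s0 : 0 < s := Bpos _ v0.
change (exists T : 'M[R]_(1 + k, n), T *m B *m T^T = 1%:M).
exists (col_mx ((Num.sqrt s)^-1 *: v) T).
rewrite mul_col_mx tr_col_mx mul_col_row TB scalar_mx_block.
have TBv : T *m B *m v^T = 0.
  by apply: trmx_inj; rewrite !trmx_mul trmxK Bsym vT trmx0.
rewrite [v *m (_ *m _)]mulmxA in vT.
congr (block_mx _ _ _ _).
- apply/matrixP => i j.
  rewrite !ord1 linearZ /= -scalemxAr -!scalemxAl scalerA mxE -/s -invfM.
  by rewrite -expr2 sqr_sqrtr ?ltW// mulVf ?gt_eqF// mxE.
- by rewrite -!scalemxAl vT scaler0.
- by rewrite linearZ /= -scalemxAr TBv scaler0.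
Qed.

End DotProduct.

(** Among the matrices whose rows satisfy Q, one of maximal rank works: a vector of Q outside its
    row space would raise the rank. Rank arguments thus apply to linear conditions on vectors. *)
Lemma subspace_mx (F : fieldType) n (Q : 'rV[F]_n -> Prop) :
  Q 0 -> (forall a u v, Q u -> Q v -> Q (a *: u + v)) ->
  exists W : 'M[F]_n, forall v, Q v <-> (v <= W)%MS.
Proof.
move=> Q0 Qlin.
have Qsub m (W : 'M[F]_(m, n)) : (forall i, Q (row i W)) ->
    forall v, (v <= W)%MS -> Q v.
  move=> QW v /submxP[D ->]; rewrite mulmx_sum_row.
  by elim/big_rec: _ => // i x _; apply: Qlin.
pose P k := `[< exists2 W : 'M[F]_n, \rank W = k & forall i, Q (row i W) >].
have exP : exists k, P k.
  by exists 0%N; apply/asboolP; exists 0; [rewrite mxrank0|move=> i;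
    rewrite row0].
have ubP k : P k -> (k <= n)%N by move=> /asboolP[W <- _]; apply: rank_leq_col.
case: (ex_maxnP exP ubP) => k /asboolP[W rW QW] maxk.
exists W => v; split; last exact: Qsub.
move=> Qv; apply: contrapT => /negP vW.
have /maxk : P (\rank (W + v)%MS).
  apply/asboolP; exists (W + v)%MS => // i.
  have : (row i (W + v)%MS <= col_mx W v)%MS.
    by rewrite -addsmxE row_sub.
  apply: Qsub => j; rewrite -[j]splitK; case: (fintype.split j) => j' /=.
    by rewrite rowKu.
  by rewrite rowKd row_id.
rewrite -rW leqNgt => /negP; apply.
apply: rank_ltmx; rewrite /ltmx addsmxSl/=; apply: contra vW.
exact: submx_trans (addsmxSr _ _).
Qed.

(** * Metric Lie algebras *)

Lemma addmxE {V : zmodType} m n (A B : 'M[V]_(m, n)) i j :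
  (A + B) i j = A i j + B i j.
Proof. by rewrite mxE. Qed.

Lemma oppmxE {V : zmodType} m n (A : 'M[V]_(m, n)) i j : (- A) i j = - A i j.
Proof. by rewrite mxE. Qed.

Section MetricLieAlgebra.
Context {R : rcfType} {n : nat} (Gam : {linear 'rV[R]_n -> 'M[R]_n}).
Implicit Types (x y z w : 'rV[R]_n) (S T K P h : 'M[R]_n).

(* [y *m Gam x] is nabla_x y; curv acts on row vectors, on the right, whence the
   order of the factors. *)
Definition lie x y := y *m Gam x - x *m Gam y.

Definition curv x y := Gam y *m Gam x - Gam x *m Gam y - Gam (lie x y).

(** Generators of the infinitesimal holonomy algebra: [hol_bracket] is, up to sign, the covariant
    derivative of h taken as a left-invariant field of endomorphisms. No linear span is taken, since
    commuting with [hol] and being killed by it are linear conditions anyway. *)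
Inductive hol : 'M[R]_n -> Prop :=
| hol_curv x y : hol (curv x y)
| hol_bracket x h : hol h -> hol (Gam x *m h - h *m Gam x).

Hypothesis skew : forall x, (Gam x)^T = - Gam x.
Hypothesis jacobi :
  forall x y z, lie x (lie y z) + lie y (lie z x) + lie z (lie x y) = 0.

Lemma dot_skew x y z : dot (y *m Gam x) z = - dot y (z *m Gam x).
Proof. by rewrite dot_mulmx skew mulmxN dotNr. Qed.

Lemma lieC x y : lie y x = - lie x y.
Proof. by rewrite /lie opprB. Qed.

Lemma curvC x y : curv y x = - curv x y.
Proof.
rewrite /curv lieC linearN/=.
by apply/matrixP => i j; rewrite !(addmxE, oppmxE); ring.
Qed.

Lemma curv_tr x y : (curv x y)^T = - curv x y.
Proof.
rewrite /curv !raddfB/= !trmx_mul !skew !mulmxN !mulNmx.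
by apply/matrixP => i j; rewrite !(addmxE, oppmxE); ring.
Qed.

Lemma hol_skew h : hol h -> h^T = - h.
Proof.
elim=> {h} [x y|x h _ IH]; first exact: curv_tr.
by rewrite raddfB/= !trmx_mul IH skew !mulmxN !mulNmx !opprK opprB.
Qed.

(** The first Bianchi identity: as [lie] is the antisymmetrisation of the connection, the cyclic sum
    of the curvature equals the Jacobi sum. *)
Lemma bianchi x y z :
  z *m curv x y + x *m curv y z + y *m curv z x = 0.
Proof.
rewrite -(jacobi x y z).
have lieEl u v w : lie u (lie v w) = lie v w *m Gam u - u *m Gam (lie v w) by
  [].
rewrite !lieEl.
have lieE u v w : lie u v *m Gam w = v *m Gam u *m Gam w - u *m Gam v *m Gam w.
  by rewrite /lie mulmxBl.
apply/rowP => i; rewrite /curv !mulmxBr !lieE !mulmxA.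
by rewrite !(addmxE, oppmxE); ring.
Qed.

(** A formal consequence of the antisymmetry in each pair and of Bianchi's identity, taken for the
    four cyclic shifts of (x, y, z, w). *)
Lemma curv_pair x y z w :
  dot (z *m curv x y) w = dot (x *m curv z w) y.
Proof.
pose r x y z w := dot (z *m curv x y) w.
have a1 x' y' z' w' : r y' x' z' w' = - r x' y' z' w'.
  by rewrite /r curvC mulmxN dotNl.
have a2 x' y' z' w' : r x' y' w' z' = - r x' y' z' w'.
  by rewrite /r dot_mulmx curv_tr mulmxN dotNr dotC.
have b x' y' z' w' : r x' y' z' w' + r y' z' x' w' + r z' x' y' w' = 0.
  by rewrite /r -!dotDl bianchi dot0l.
have := b x y z w; have := b y z w x; have := b z w x y; have := b w x y z.
have := a2 y z x w; have := a2 z w x y; have := a1 y w z x.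
have := a2 y w x z; have := a2 w x z y; have := a1 z x w y.
have := a2 z x y w; have := a2 x y z w.
change (dot (z *m curv x y) w) with (r x y z w).
change (dot (x *m curv z w) y) with (r z w x y).
move: r {a1 a2 b} => r; lra.
Qed.

(** Commutation lets S pass between the last two arguments of r, and by pair symmetry also between
    the first two. Comparing two instances of Bianchi's identity, with S on the first and on the
    last argument, gives the symmetry [f23]. *)
Lemma curv_symmetric_commute S : S^T = S ->
  (forall x y, curv x y *m S = S *m curv x y) ->
  forall x y, curv (x *m S) y = curv x y *m S.
Proof.
move=> Ssym SC x y.
pose r x y z w := dot (z *m curv x y) w.
have a1 x' y' z' w' : r y' x' z' w' = - r x' y' z' w'.
  by rewrite /r curvC mulmxN dotNl.
have SR x' y' z' w' : r x' y' (z' *m S) w' = r x' y' z' (w' *m S).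
  by rewrite /r -mulmxA -SC mulmxA dot_mulmx Ssym.
have RS x' y' z' w' : r (x' *m S) y' z' w' = r x' (y' *m S) z' w'.
  by rewrite /r curv_pair [RHS]curv_pair; exact: SR.
have b x' y' z' w' : r x' y' z' w' + r y' z' x' w' + r z' x' y' w' = 0.
  by rewrite /r -!dotDl bianchi dot0l.
(* f is antisymmetric in its first two arguments and symmetric in the next two,
   hence vanishes. *)
pose f x y z w := r (x *m S) y z w - r x y z (w *m S).
have f12 x' y' z' w' : f y' x' z' w' = - f x' y' z' w'.
  by rewrite /f RS a1 [r y' x' _ _]a1 opprB opprK addrC.
have f23 x' y' z' w' : f x' z' y' w' = f x' y' z' w'.
  have := b (x' *m S) y' z' w'; have := b x' y' z' (w' *m S).
  by rewrite SR (a1 (x' *m S) z') (a1 x' z') /f; lra.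
have f0 x' y' z' w' : f x' y' z' w' = 0.
  have := f12 x' y' z' w'; have := f23 y' x' z' w'; have := f12 y' z' x' w'.
  have := f23 z' y' x' w'; have := f12 z' x' y' w'; have := f23 x' y' z' w'.
  by move: f {f12 f23} => f; lra.
apply/row_matrixP => i; apply: dot_inj => w; rewrite !rowE mulmxA.
by apply/eqP; rewrite [X in _ == X]dot_mulmx Ssym -subr_eq0; apply/eqP/f0.
Qed.

Definition hol_commutant S := S^T = S /\ forall h, hol h -> h *m S = S *m h.

(** Symmetry survives because [Gam x] is skew. Commutation with h comes from the Jacobi identity for
    commutators, as [hol] contains the bracket of [Gam x] with h. *)
Lemma hol_commutant_bracket x S :
  hol_commutant S -> hol_commutant (Gam x *m S - S *m Gam x).
Proof.
move=> [Ssym SC]; split.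
  by rewrite raddfB/= !trmx_mul Ssym !skew mulmxN mulNmx opprK addrC.
move=> h hh; have := SC _ (hol_bracket x hh); have := SC _ hh.
rewrite !mulmxBr !mulmxBl !mulmxA => hS.
have -> : S *m h *m Gam x = h *m S *m Gam x by rewrite hS.
have -> : Gam x *m h *m S = Gam x *m S *m h by rewrite -!mulmxA hS.
move=> /matrixP e; apply/matrixP => i j; move: (e i j).
by rewrite !(addmxE, oppmxE); lra.
Qed.

(** On a curvature, S and T can be pulled out of [curv (x *m S) (y *m T)] in either order. The
    bracket case differentiates [(S *m T - T *m S) *m h = 0] along [Gam x]: the extra terms vanish
    by the induction hypothesis for ([Gam x, S], T) and (S, [Gam x, T]), which is why S and T are
    generalised. *)
Lemma commutator_hol S T h : hol_commutant S -> hol_commutant T -> hol h ->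
  (S *m T - T *m S) *m h = 0.
Proof.
move=> CS CT hh; elim: hh S T CS CT => {h} [x y|x h hh IHh] S T CS CT.
  have cS := curv_symmetric_commute CS.1 (fun x y => CS.2 _ (hol_curv x y)).
  have cT := curv_symmetric_commute CT.1 (fun x y => CT.2 _ (hol_curv x y)).
  have cTr u v : curv u (v *m T) = curv u v *m T.
    by rewrite curvC cT -mulNmx -curvC.
  have e : curv (x *m S) (y *m T) = curv x y *m S *m T by rewrite cTr cS.
  have : curv (x *m S) (y *m T) = curv x y *m T *m S by rewrite cS cTr.
  rewrite e [(_ - _) *m curv x y]mulmxBl; have ST U V : hol_commutant U ->
    hol_commutant V ->
    U *m V *m curv x y = curv x y *m U *m V.
    move=> CU CV; rewrite -mulmxA -(CV.2 _ (hol_curv x y)) mulmxA.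
    by rewrite -(CU.2 _ (hol_curv x y)).
  by rewrite !ST// => ->; rewrite subrr.
have := IHh _ _ (hol_commutant_bracket x CS) CT.
have := IHh _ _ CS (hol_commutant_bracket x CT).
have := IHh _ _ CS CT.
rewrite !mulmxBr !mulmxBl !mulmxA => /eqP; rewrite subr_eq0 => /eqP STh.
have GSTh : Gam x *m S *m T *m h = Gam x *m T *m S *m h.
  by rewrite -!mulmxA [S *m _]mulmxA STh -mulmxA.
rewrite STh => /matrixP e2 /matrixP e3.
apply/matrixP => i j; move: (e2 i j) (e3 i j).
have -> : (0 : 'M[R]_n) i j = 0 by rewrite mxE.
by rewrite GSTh !(addmxE, oppmxE); lra.
Qed.

Lemma hol_commutantC S T :
  (forall v : 'rV_n, (forall h, hol h -> v *m h = 0) -> v = 0) ->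
  hol_commutant S -> hol_commutant T -> S *m T = T *m S.
Proof.
move=> hol0 CS CT; apply/eqP; rewrite -subr_eq0; apply/eqP/row_matrixP => i.
rewrite row0; apply: hol0 => h hh.
by rewrite -row_mul (commutator_hol CS CT hh) row0.
Qed.

(* A derivation of a commutative algebra kills idempotents. *)
Lemma hol_commutant_idempotent P x :
  (forall v : 'rV_n, (forall h, hol h -> v *m h = 0) -> v = 0) ->
  hol_commutant P -> P *m P = P -> Gam x *m P = P *m Gam x.
Proof.
move=> hol0 CP PP.
set D := Gam x *m P - P *m Gam x.
have DP : P *m D = D *m P.
  by apply: hol_commutantC => //; apply: hol_commutant_bracket.
have DE : D = D *m P + P *m D.
  by rewrite /D mulmxBl mulmxBr !mulmxA PP -!mulmxA PP subrKA.
have PD0 : P *m D = 0.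
  have : P *m D = P *m D + P *m D.
    by rewrite {1}DE mulmxDr mulmxA DP -!mulmxA PP mulmxA DP -mulmxA PP.
  by move/eqP; rewrite -subr_eq0 opprD addNKr oppr_eq0 => /eqP.
by apply/eqP; rewrite -subr_eq0 -/D DE -DP PD0 addr0.
Qed.

(** * The flat case *)

Definition trace_form x y := - \tr (Gam x *m Gam y).

(** Flatness makes [Gam] send [lie] to the reversed commutator; the cyclicity of the trace then
    shows that [lie x] acts skewly for the trace form. *)
Lemma trace_form_lie x y z : (forall x y, curv x y = 0) ->
  trace_form (lie x y) z = - trace_form (lie x z) y.
Proof.
move=> flat; rewrite /trace_form.
have GL u v : Gam (lie u v) = Gam v *m Gam u - Gam u *m Gam v.
  by apply/eqP; rewrite eq_sym -subr_eq0; apply/eqP/flat.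
have t1 : \tr (Gam z *m Gam x *m Gam y) = \tr (Gam x *m Gam y *m Gam z).
  by rewrite -mulmxA mxtrace_mulC.
have t2 : \tr (Gam x *m Gam z *m Gam y) = \tr (Gam y *m Gam x *m Gam z).
  by rewrite mxtrace_mulC mulmxA.
by rewrite !GL !mulmxBl !raddfB/= t1 t2; ring.
Qed.

(** As [Gam x] is skew, the sign in [trace_form] makes [trace_form x x] the sum of the squared norms
    of the rows of [Gam x]. *)
Lemma trace_form_eq0 x : trace_form x x <= 0 -> Gam x = 0.
Proof.
have -> : trace_form x x = \sum_i dot (row i (Gam x)) (row i (Gam x)).
  have -> : trace_form x x = \tr (Gam x *m (Gam x)^T).
    by rewrite skew mulmxN raddfN.
  rewrite /mxtrace; apply: eq_bigr => i _.
  by rewrite /dot tr_row -row_mul !mxE; apply: eq_bigr => k _; rewrite !mxE.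
move=> le0; apply/row_matrixP => i; rewrite row0; apply: dot_eq0.
apply/eqP; rewrite eq_le dot_ge0 andbT (le_trans _ le0)//.
by rewrite (bigD1 i)//= lerDl sumr_ge0// => k _; rewrite dot_ge0.
Qed.

(** When [Gam] is injective the trace form is an inner product; the b i are the rows of a matrix
    that orthonormalises its Gram matrix B. *)
Lemma trace_form_basis : (forall x, Gam x = 0 -> x = 0) ->
  exists b : 'I_n -> 'rV[R]_n,
    forall x, x = \sum_i trace_form x (b i) *: b i.
Proof.
move=> Ginj.
pose B : 'M[R]_n := \matrix_(i, j) trace_form (delta_mx 0 i) (delta_mx 0 j).
have GE x : Gam x = \sum_i x 0 i *: Gam (delta_mx 0 i).
  rewrite {1}(row_sum_delta x) linear_sum.
  by apply: eq_bigr => i _; rewrite linearZ.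
have EL x y : trace_form x y = \sum_i x 0 i * trace_form (delta_mx 0 i) y.
  rewrite {1}/trace_form {1}(GE x) mulmx_suml (raddf_sum (mxtrace (n:=n))).
  rewrite -sumrN; apply: eq_bigr => i _.
  rewrite -scalemxAl /trace_form mulrN.
  by congr (- _); exact: mxtraceZ.
have sym x y : trace_form x y = trace_form y x.
  by rewrite /trace_form mxtrace_mulC.
have BE x y : (x *m B *m y^T) 0 0 = trace_form x y.
  rewrite EL -mulmxA mxE; apply: eq_bigr => i _; congr (_ * _).
  by rewrite mxE sym EL; apply: eq_bigr => j _; rewrite !mxE sym mulrC.
have [||T TB] := @gram_schmidt R n B.
- by apply/matrixP => i j; rewrite !mxE /trace_form mxtrace_mulC.
- move=> v v0; rewrite BE ltNge; apply: contra v0 => /trace_form_eq0 Gv.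
  by apply/eqP/Ginj.
exists (fun i => row i T) => x.
have TBT : B *m T^T *m T = 1%:M by apply: mulmx1C; rewrite mulmxA.
rewrite -{1}[x]mulmx1 -TBT !mulmxA mulmx_sum_row; apply: eq_bigr => i _.
by rewrite -BE tr_row !mxE; congr (_ *: _); apply: eq_bigr => k _; rewrite !mxE.
Qed.

(** Otherwise the Casimir element C would be negative definite. Since [w *m Gam x = x *m C],
    skewness gives [dot (w *m C) w = 0], so w = 0; then C = 0, which is absurd in positive
    dimension. *)
Lemma flat_common_kernel : (0 < n)%N -> (forall x y, curv x y = 0) ->
  (forall x, Gam x = 0 -> x = 0) ->
  exists2 v : 'rV_n, v != 0 & forall x, v *m Gam x = 0.
Proof.
move=> n0 flat Ginj; apply: contrapT => no_fixed.
have fixed0 (v : 'rV_n) : (forall x, v *m Gam x = 0) -> v = 0.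
  by move=> vG; apply/eqP/negPn/negP => v0; apply: no_fixed; exists v.
have [b bE] := trace_form_basis Ginj.
(* C is the Casimir element; wC applied to w itself will give w = 0. *)
pose C : 'M[R]_n := \sum_i Gam (b i) *m Gam (b i).
pose w := \sum_i b i *m Gam (b i).
have wC x : w *m Gam x = x *m C.
  apply/eqP; rewrite -subr_eq0 /w /C mulmx_suml mulmx_sumr -sumrB.
  have -> : \sum_i (b i *m Gam (b i) *m Gam x - x *m (Gam (b i) *m Gam (b i)))
     = \sum_i (lie x (b i) *m Gam (b i) + b i *m Gam (lie x (b i))).
    apply: eq_bigr => i _.
    have /eqP := flat x (b i); rewrite subr_eq0 => /eqP <-.
    rewrite /lie mulmxBl mulmxBr !mulmxA; apply/rowP => j.
    by rewrite !(addmxE, oppmxE); ring.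
  (* The matrix of [lie x] in the basis b. It is antisymmetric by [trace_form_lie], so the two
     double sums cancel once the indices of one are exchanged. *)
  pose M i j := trace_form (lie x (b i)) (b j).
  have -> : \sum_i (lie x (b i) *m Gam (b i) + b i *m Gam (lie x (b i))) =
      \sum_i \sum_j M i j *: (b j *m Gam (b i)) +
      \sum_i \sum_j M i j *: (b i *m Gam (b j)).
    rewrite -big_split; apply: eq_bigr => i _ /=.
    rewrite {1 2}(bE (lie x (b i))) linear_sum/= mulmx_suml mulmx_sumr.
    by congr (_ + _); apply: eq_bigr => j _; rewrite ?linearZ/= -?scalemxAl
      -?scalemxAr.
  rewrite exchange_big/= -big_split big1//= => i _.
  rewrite -big_split big1//= => j _.
  by rewrite /M trace_form_lie// scaleNr addNr.
(* [- dot (v *m C) v] is the sum of the squared norms of the [v *m Gam (b i)]; if it vanishes, v is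
   killed by every [Gam x], since the b i span. *)
have Cker (v : 'rV_n) : dot (v *m C) v = 0 -> v = 0.
  have -> : dot (v *m C) v = - \sum_i dot (v *m Gam (b i)) (v *m Gam (b i)).
    rewrite /C mulmx_sumr dotC dot_sumr -sumrN; apply: eq_bigr => i _.
    by rewrite dotC mulmxA dot_skew.
  move=> /eqP; rewrite oppr_eq0 psumr_eq0 => [/allP v0|i _];
    last exact: dot_ge0.
  apply: fixed0 => x; rewrite (bE x) linear_sum/= mulmx_sumr big1// => i _.
  rewrite linearZ/= -scalemxAr (dot_eq0 (u := v *m Gam (b i))) ?scaler0//.
  by apply/eqP/v0; rewrite mem_index_enum.
have w0 : w = 0.
  apply: Cker; rewrite -wC.
  by have := dot_skew w w w; rewrite [dot w _]dotC; lra.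
have : delta_mx 0 (Ordinal n0) = 0 :> 'rV[R]_n.
  by apply: Cker; rewrite -wC w0 mul0mx dot0l.
by move/rowP/(_ (Ordinal n0))/eqP; rewrite !mxE !eqxx oner_eq0.
Qed.

(** The kernel U of [Gam] is stable: for [Gam u = 0], flatness reduces to [Gam (u *m Gam x) = 0]. If
    U is zero, the space K of vectors killed by all [Gam x] is nonzero by [flat_common_kernel], and
    proper because [Gam = 0] would contradict injectivity. *)
Lemma flat_invariant_subspace : (1 < n)%N -> (forall x y, curv x y = 0) ->
  exists W : 'M[R]_n, (0 < \rank W < n)%N /\ forall x, (W *m Gam x <= W)%MS.
Proof.
move=> n1 flat.
have n0 : (0 < n)%N := ltnW n1.
have [U UP] : exists U : 'M[R]_n, forall v, Gam v = 0 <-> (v <= U)%MS.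
  apply: subspace_mx; first by rewrite linear0.
  by move=> a u v u0 v0; rewrite linearP/= u0 v0 scaler0 addr0.
have Uinv x : (U *m Gam x <= U)%MS.
  apply/row_subP => i; rewrite row_mul; apply/UP.
  have Ui : Gam (row i U) = 0 by apply/UP; rewrite row_sub.
  have := flat x (row i U); rewrite /curv /lie Ui mul0mx mulmx0 subrr.
  by rewrite mulmx0 subr0 sub0r => /eqP; rewrite oppr_eq0 => /eqP.
have [r0|r0] := posnP (\rank U); last first.
  have [rn|rn] := ltnP (\rank U) n; first by exists U; rewrite r0 rn.
  have G0 x : Gam x = 0.
    by apply/UP/submx_full; rewrite /row_full eqn_leq rank_leq_col rn.
  (* Here [Gam] is zero and every subspace is stable; a line is proper because n > 1. *)
  exists (pid_mx 1); rewrite rank_pid_mx ?n1//.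
  by split=> // x; rewrite G0 mulmx0 sub0mx.
have Ginj x : Gam x = 0 -> x = 0.
  have /eqP U0 : U == 0 by rewrite -mxrank_eq0 r0.
  by move=> /UP; rewrite U0 submx0 => /eqP.
have [v v0 vG] := flat_common_kernel n0 flat Ginj.
have [K KP] : exists K : 'M[R]_n,
    forall v : 'rV_n, (forall x, v *m Gam x = 0) <-> (v <= K)%MS.
  apply: (subspace_mx (Q := fun v => forall x, v *m Gam x = 0)).
    by move=> x; rewrite mul0mx.
  move=> a u w u0 w0 x.
  by rewrite mulmxDl -scalemxAl u0 w0 scaler0 addr0.
exists K; split; last first.
  move=> x; apply/row_subP => i; rewrite row_mul.
  suff -> : row i K *m Gam x = 0 by rewrite sub0mx.
  by move: x; apply/KP; rewrite row_sub.
apply/andP; split.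
  rewrite lt0n mxrank_eq0; apply: contra v0 => /eqP K0.
  by rewrite -submx0 -K0; apply/KP.
rewrite ltnNge; apply/negP => nK.
have G0 x : Gam x = 0.
  apply/row_matrixP => i; rewrite row0 rowE; move: x; apply/KP/submx_full.
  by rewrite /row_full eqn_leq rank_leq_col nK.
by move/eqP: v0; apply; apply: Ginj.
Qed.

Lemma invariant_subspace P : P^T = P -> P *m P = P -> (0 < \rank P < n)%N ->
  (forall h, hol h -> h *m P = P *m h) ->
  exists W : 'M[R]_n, (0 < \rank W < n)%N /\ forall x, (W *m Gam x <= W)%MS.
Proof.
move=> Psym PP rP PC.
have [K KP] : exists K : 'M[R]_n,
    forall v : 'rV_n, (forall h, hol h -> v *m h = 0) <-> (v <= K)%MS.
  apply: (subspace_mx (Q := fun v => forall h, hol h -> v *m h = 0)).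
    by move=> x; rewrite mul0mx.
  move=> a u w u0 w0 x hx.
  by rewrite mulmxDl -scalemxAl u0// w0// scaler0 addr0.
have [rK|rK] := posnP (\rank K).
  exists P; split=> // x; rewrite -(@hol_commutant_idempotent P x) ?submxMl//.
  have /eqP K0 : K == 0 by rewrite -mxrank_eq0 rK.
  by move=> v /KP; rewrite K0 submx0 => /eqP.
have [rn|rn] := ltnP (\rank K) n.
  exists K; rewrite rK rn; split=> // x.
  apply/row_subP => i; rewrite row_mul; apply/KP => h hh.
  have Ki h' : hol h' -> row i K *m h' = 0.
    by move: h'; apply/KP; rewrite row_sub.
  (* A vector v of K satisfies [v *m h = 0], so the bracket acts on it as [v *m Gam x *m h]. *)
  have := Ki _ (hol_bracket x hh).
  by rewrite mulmxBr !mulmxA (Ki h)// mul0mx subr0.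
apply: flat_invariant_subspace.
  by case/andP: rP => r0 rn'; apply: leq_ltn_trans rn'.
move=> x y; apply/row_matrixP => i; rewrite row0 rowE.
have : ((delta_mx 0 i : 'rV_n) <= K)%MS.
  by apply: submx_full; rewrite /row_full eqn_leq rank_leq_col rn.
by move/KP; apply; constructor.
Qed.

(** * Orthogonal subalgebras and the connection *)

Lemma dot_lie x y z : dot (lie x y) z = dot (y *m Gam x) z - dot (x *m Gam y) z.
Proof. by rewrite /lie dotDl dotNl. Qed.

Lemma dot_skew_self x y : dot (y *m Gam x) y = 0.
Proof. by have := dot_skew x y y; rewrite [dot y _]dotC; lra. Qed.

(** Let b be the Q2-component of [y *m Gam x], and x = u + v. In [dot (y *m Gam u) b], the part
    antisymmetric in u and y vanishes because Q1 is a subalgebra orthogonal to Q2, the symmetric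
    part by polarising [c1]. The term in v is [- dot y (b *m Gam v)], treated alike with Q1 and Q2
    exchanged. *)
Lemma orthogonal_subalgebras_invariant (Q1 Q2 : 'rV[R]_n -> Prop) :
  (forall x y, Q1 x -> Q1 y -> Q1 (x + y)) ->
  (forall x y, Q2 x -> Q2 y -> Q2 (x + y)) ->
  (forall x y, Q1 x -> Q1 y -> Q1 (lie x y)) ->
  (forall x y, Q2 x -> Q2 y -> Q2 (lie x y)) ->
  (forall x, exists y z, [/\ Q1 y, Q2 z & x = y + z]) ->
  (forall x y, Q1 x -> Q2 y -> dot x y = 0) ->
  (forall x y, Q1 x -> Q2 y -> dot (lie x y) y = 0 /\ dot (lie x y) x = 0) ->
  forall x y, Q1 y -> Q1 (y *m Gam x).
Proof.
move=> D1 D2 L1 L2 dec orth cond x y Qy.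
(* Skewness turns [dot (lie u z) u = 0] into the orthogonality of [u *m Gam u] to Q2. *)
have c1 u z : Q1 u -> Q2 z -> dot (u *m Gam u) z = 0.
  move=> Qu Qz; have [_] := cond _ _ Qu Qz.
  by rewrite dot_lie dot_skew_self subr0 dot_skew dotC => /eqP;
    rewrite oppr_eq0 => /eqP.
have c2 u z : Q1 u -> Q2 z -> dot (z *m Gam z) u = 0.
  move=> Qu Qz; have [+ _] := cond _ _ Qu Qz.
  by rewrite dot_lie dot_skew_self sub0r dot_skew opprK dotC.
have pol u v z : dot ((u + v) *m Gam (u + v)) z = dot (u *m Gam u) z +
    dot (v *m Gam v) z + dot (u *m Gam v) z + dot (v *m Gam u) z.
  by rewrite linearD mulmxDr !mulmxDl !dotDl; ring.
have [a [b [Qa Qb yE]]] := dec (y *m Gam x).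
have [u [v [Qu Qv xE]]] := dec x.
suff b0 : b = 0 by rewrite yE b0 addr0.
apply: dot_eq0.
have -> : dot b b = dot (y *m Gam x) b by rewrite yE dotDl (orth _ _ Qa Qb)
  add0r.
rewrite xE linearD mulmxDr dotDl.
have e1 := orth _ _ (L1 _ _ Qu Qy) Qb; have e2 := c1 _ _ (D1 _ _ Qu Qy) Qb.
have e3 := orth _ _ Qy (L2 _ _ Qv Qb); have e4 := c2 _ _ Qy (D2 _ _ Qv Qb).
rewrite dotC dot_lie in e3; rewrite dot_lie in e1.
rewrite pol (c1 _ _ Qu Qb) (c1 _ _ Qy Qb) in e2.
rewrite pol (c2 _ _ Qy Qv) (c2 _ _ Qy Qb) in e4.
have := dot_skew v y b; rewrite [dot y _]dotC.
lra.
Qed.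

End MetricLieAlgebra.

(** [b x y z] is Koszul's formula for the product of nabla_x y with z when the inner products of
    fields are constant. Its antisymmetry in y and z makes [Gam x] skew; its change under the
    exchange of x and y is the bracket. *)
Lemma koszul_connection (R : rcfType) n (br : 'rV[R]_n -> 'rV[R]_n -> 'rV[R]_n)
  :
  (forall k x y z, br (k *: x + y) z = k *: br x z + br y z) ->
  (forall x y, br y x = - br x y) ->
  exists Gam : {linear 'rV[R]_n -> 'M[R]_n},
    (forall x, (Gam x)^T = - Gam x) /\ forall x y, lie Gam x y = br x y.
Proof.
move=> brl brC.
have brr k x y z : br z (k *: x + y) = k *: br z x + br z y.
  by rewrite brC brl opprD -scalerN -!brC.
pose b x y z := 2^-1 * (dot (br x y) z - dot (br y z) x + dot (br z x) y).
pose e (i : 'I_n) : 'rV[R]_n := delta_mx 0 i.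
pose G x : 'M[R]_n := \matrix_(i, j) b x (e i) (e j).
have Glin : linear G.
  move=> k x y; apply/matrixP => i j; rewrite !mxE /b brl brr.
  by rewrite !(dotDl, dotDr, dotZl, dotZr); ring.
have [Gam GE] : exists Gam : {linear 'rV[R]_n -> 'M[R]_n}, forall x,
  Gam x = G x.
  pose GM := GRing.isLinear.Build _ _ _ _ _ Glin.
  by pose l : {linear 'rV[R]_n -> 'M[R]_n} := HB.pack G GM; exists l.
exists Gam; split=> [x|x y].
  apply/matrixP => i j; rewrite !GE !mxE /b.
  rewrite (brC (e i) (e j)) (brC x (e i)) (brC (e j) x) !dotNl.
  by ring.
have bE u v j : (v *m Gam u) 0 j = b u v (e j).
  have blin : linear (fun v => b u v (e j) : R^o).
    move=> k w z; rewrite /b brl brr /GRing.scale/=.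
    by rewrite !(dotDl, dotDr, dotZl, dotZr); ring.
  pose bM := GRing.isLinear.Build _ _ _ _ _ blin.
  pose l : {linear 'rV[R]_n -> R^o} := HB.pack (fun v => b u v (e j) : R^o) bM.
  rewrite mxE -[RHS]/(l v) {2}(row_sum_delta v) linear_sum.
  by apply: eq_bigr => i _; rewrite linearZ/= GE mxE.
apply/rowP => j; rewrite /lie addmxE oppmxE !bE /b.
rewrite (brC x y) (brC (e j) x) (brC y (e j)) !dotNl -[br x y in RHS]/(br x y).
rewrite -[RHS](dot_delta (br x y) j).
by field.
Qed.

(** * Smooth maps between normed spaces *)

Section SmoothOn.
Context {R : realType}.
Implicit Types V W Z : normedModType R.

Lemma open_near (T : topologicalType) (U : set T) x :
  open U -> U x -> \forall y \near x, U y.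
Proof. by move=> oU Ux; apply: open_nbhs_nbhs. Qed.

Lemma near_eq_differentiable V W (f g : V -> W) x :
  (\near x, f x = g x) -> differentiable f x -> differentiable g x.
Proof.
move=> fg /diff_locallyP[dfc dfo].
have fgx : f x = g x := nbhs_singleton fg.
have go : g \o shift x = cst (g x) + 'd f x +o_ 0 id.
  apply/eqaddoP => e e0; move/eqaddoP : dfo => /(_ e e0) dfo.
  have fg0 : \forall y \near 0, f (y + x) = g (y + x).
    by move: fg; rewrite (near_shift 0) subr0.
  near=> y.
  have -> : (g \o shift x - (cst (g x) + 'd f x)) y =
            (f \o shift x - (cst (f x) + 'd f x)) y.
    rewrite -fgx; congr (_ - _) => /=; apply/esym; near: y; exact: fg0.
  by near: y.
have dE := diff_unique dfc go.
by apply/diff_locallyP; rewrite dE.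
Unshelve. all: by end_near. Qed.

Lemma scaler_is_bilinear W : bilinear_for
  (GRing.Scale.Law.clone _ _ *:%R _) (GRing.Scale.Law.clone _ _ *:%R _)
  (@GRing.scale R W).
Proof.
by split=> [u'|u] a x y /=; rewrite ?scalerDl ?scalerDr ?scalerA// mulrC.
Qed.

Lemma differentiable_scale V W (f : V -> R) (g : V -> W) x :
  differentiable f x -> differentiable g x ->
  differentiable (fun y => f y *: g y) x /\
  forall v, 'D_v (fun y => f y *: g y) x = 'D_v f x *: g x + f x *: 'D_v g x.
Proof.
move=> df dg.
pose bM := bilinear_isBilinear.Build R R W W _ _ (@GRing.scale R W)
  (scaler_is_bilinear W).
pose b : {bilinear R -> W -> W} := HB.pack (@GRing.scale R W) bM.
have cb : continuous (fun p : R * W => b p.1 p.2).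
  by move=> p; exact: scale_continuous.
have db p := @differentiable_bilin _ _ _ _ b p cb.
have dfg := differentiable_pair df dg.
have d := differentiable_comp dfg (db _).
split=> [|v]; first exact: d.
rewrite -[LHS]/('D_v ((fun p => b p.1 p.2) \o (fun y => (f y, g y))) x).
rewrite (deriveE _ d) (diff_comp dfg (db _)).
transitivity ('d (fun p => b p.1 p.2) (f x, g x)
  ('d (fun y => (f y, g y)) x v)) => //.
by rewrite (diff_bilin _ cb) (diff_pair df dg) /= !deriveE// addrC.
Qed.

Implicit Type k : nat.

Lemma times_differentiable_sub V W k (U U' : set V) (f : V -> W) :
  U' `<=` U -> times_differentiable k U f -> times_differentiable k U' f.
Proof.
move=> UU; elim: k f => //= k IH f [df Df]; split=> [x /UU|v]; first exact: df.
exact/IH/Df.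
Qed.

Lemma times_differentiableW V W k (U : set V) (f : V -> W) :
  times_differentiable k.+1 U f -> times_differentiable k U f.
Proof.
elim: k f => //= k IH f [df Df]; split=> // v.
by apply: IH; exact: Df.
Qed.

Lemma eq_times_differentiable V W k (U : set V) (f g : V -> W) : open U ->
  (forall x, U x -> f x = g x) ->
  times_differentiable k U f -> times_differentiable k U g.
Proof.
move=> oU; elim: k f g => //= k IH f g fg [df Df].
have nfg x : U x -> \near x, f x = g x.
  by move=> Ux; near=> y; apply: fg; near: y; exact: open_near.
split=> [x Ux|v].
  by apply: near_eq_differentiable (nfg _ Ux) _; exact: df.
by apply: IH (Df v) => x Ux; apply: near_eq_derive; exact: nfg.
Unshelve. all: by end_near. Qed.

Lemma times_differentiable_cst V W k (U : set V) (c : W) :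
  times_differentiable k U (fun=> c).
Proof.
elim: k c => //= k IH c; split=> [x _|v]; first exact: differentiable_cst.
have -> : (fun x : V => 'D_v (fun=> c) x) = (fun=> 0).
  by apply/funext => x; exact: derive_cst.
exact: IH.
Qed.

Lemma times_differentiable_linear V W Z k (U : set V) (f : V -> W)
    (l : {linear W -> Z}) : open U -> continuous l ->
  times_differentiable k U f -> times_differentiable k U (l \o f).
Proof.
move=> oU cl; elim: k f => //= k IH f [df Df]; split=> [x Ux|v].
  by apply: differentiable_comp; [exact: df|exact: linear_differentiable].
apply: eq_times_differentiable oU _ (IH _ (Df v)) => x Ux /=.
have dl := @linear_differentiable _ _ _ l (f x) cl.
rewrite (deriveE _ (df _ Ux)) (deriveE _ (differentiable_comp (df _ Ux) dl)).
rewrite (diff_comp (df _ Ux) dl) /=.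
by rewrite (diff_lin (f x) cl).
Qed.

Lemma times_differentiableD V W k (U : set V) (f g : V -> W) : open U ->
  times_differentiable k U f -> times_differentiable k U g ->
  times_differentiable k U (fun x => f x + g x).
Proof.
move=> oU; elim: k f g => //= k IH f g [df Df] [dg Dg]; split=> [x Ux|v].
  by apply: (@differentiableD _ _ _ f g); [exact: df|exact: dg].
apply: eq_times_differentiable oU _ (IH _ _ (Df v) (Dg v)) => x Ux /=.
by apply/esym; apply: (@deriveD _ _ _ f g); apply: diff_derivable;
  [exact: df|exact: dg].
Qed.

Lemma times_differentiable_scale V W k (U : set V) (f : V -> R) (g : V -> W) :
  open U -> times_differentiable k U f -> times_differentiable k U g ->
  times_differentiable k U (fun x => f x *: g x).
Proof.
move=> oU; elim: k f g => // k IH f g Hf Hg.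
have [/times_differentiableW Hf' /times_differentiableW Hg'] := (Hf, Hg).
move: Hf Hg => /= [df Df] [dg Dg]; split=> [x Ux|v].
  by have [] := differentiable_scale (df _ Ux) (dg _ Ux).
apply: eq_times_differentiable oU _
  (times_differentiableD oU (IH _ _ (Df v) Hg') (IH _ _ Hf' (Dg v))) => x Ux /=.
by have [_ ->] := differentiable_scale (df _ Ux) (dg _ Ux).
Qed.

Lemma times_differentiable_sum V W k (U : set V) (I : Type) (r : seq I)
    (P : pred I) (f : I -> V -> W) : open U ->
  (forall i, P i -> times_differentiable k U (f i)) ->
  times_differentiable k U (fun x => \sum_(i <- r | P i) f i x).
Proof.
move=> oU Hf; elim: r => [|i r IH].
  under eq_fun do rewrite big_nil; exact: times_differentiable_cst.
under eq_fun do rewrite big_cons.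
case Pi : (P i); last exact: IH.
by apply: times_differentiableD => //; exact: Hf.
Qed.

Lemma times_differentiable_inv V k (U : set V) (f : V -> R) : open U ->
  (forall x, U x -> f x != 0) -> times_differentiable k U f ->
  times_differentiable k U (fun x => (f x)^-1).
Proof.
move=> oU f0; elim: k f f0 => // k IH f f0 Hf.
have Hi := IH _ f0 (times_differentiableW Hf).
move: Hf => /= [df Df]; split=> [x Ux|v].
  by apply: differentiableV; [exact: df|exact: f0].
have H := times_differentiable_scale oU
  (times_differentiable_scale oU Hi Hi) (Df v).
have HN := times_differentiable_scale oU
  (@times_differentiable_cst V R k U (-1)) H.
apply: (eq_times_differentiable oU _ HN) => x Ux /=.
rewrite [RHS]deriveE; last by apply: differentiableV; [exact: df|exact: f0].
rewrite diffV//=; [|exact: df|exact: f0].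
rewrite -deriveE; last exact: df.
by rewrite scaleN1r scaleNr expr2 /GRing.scale/= invfM.
Qed.

(** The derivative dl of l is the same at all points, so deriving [f \o l] along v gives the
    derivative of f along [dl v], composed with l, and the induction closes. The maps l used later
    are the slices y |-> (c, y) and y |-> (y, c). *)
Lemma times_differentiable_comp_affine V W Z k (U : set V) (S : set W)
    (f : W -> Z) (l dl : V -> W) : open U -> (forall x, is_diff x l dl) ->
  (forall x, U x -> S (l x)) -> times_differentiable k S f ->
  times_differentiable k U (f \o l).
Proof.
move=> oU Hl US; elim: k f => //= k IH f [df Df].
have dlx x : differentiable l x by apply: ex_diff; exact: Hl.
split=> [x Ux|v]; first by apply: differentiable_comp => //; exact/df/US.
apply: eq_times_differentiable oU _ (IH _ (Df (dl v))) => x Ux /=.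
have dfl := df _ (US _ Ux).
rewrite !deriveE//; last exact: differentiable_comp.
have dE : 'd l x = dl :> (V -> W) by apply: diff_val; exact: Hl.
by rewrite (diff_comp (dlx x) dfl) /= dE.
Qed.

Lemma times_differentiable_coord V m n k (U : set V) (f : V -> 'M[R]_(m,
  n)) i j :
  open U -> times_differentiable k U f ->
  times_differentiable k U (fun x => f x i j).
Proof.
move=> oU; have @l : {linear 'M[R]_(m, n) -> R}.
  by exists (fun N : 'M[R]_(_, _) => N i j); do 2![eexists]; do ?[constructor];
     rewrite ?mxE// => ? *; rewrite ?mxE//; move=> ?; rewrite !mxE.
move=> Hf; apply: (@times_differentiable_linear _ _ _ _ _ _ l) => //.
exact: coord_continuous.
Qed.

Lemma times_differentiable_rV V n k (U : set V) (f : V -> 'rV[R]_n) : open U ->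
  (forall j, times_differentiable k U (fun x => f x 0 j)) ->
  times_differentiable k U f.
Proof.
move=> oU Hf.
have -> : f = (fun x => \sum_j f x 0 j *: delta_mx 0 j).
  by apply/funext => x; exact: row_sum_delta.
apply: times_differentiable_sum => // j _.
apply: times_differentiable_scale => //; exact: times_differentiable_cst.
Qed.

End SmoothOn.

(** * Symmetry of second derivatives *)

Section Schwarz.
Context {R : realType} {V : normedModType R}.

Lemma is_derive_line (f : V -> R) (u y : V) (t : R) :
  differentiable f (t *: u + y) ->
  is_derive t 1 (fun s : R => f (s *: u + y)) ('D_u f (t *: u + y)).
Proof.
move=> df; pose l (s : R) := s *: u + y.
have dl : is_diff t l (fun s => s *: u).
  have := is_diffD (is_diff_scalel t u) (is_diff_cst y t).
  by rewrite addr0.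
have dlt : differentiable l t by apply: ex_diff.
have dlE : 'd l t = *:%R^~ u :> (R -> V) by apply: diff_val.
have dfl : differentiable (f \o l) t by apply: differentiable_comp.
apply: DeriveDef; first exact: diff_derivable.
rewrite (deriveE _ dfl) (diff_comp dlt df) /= dlE (deriveE _ df).
by rewrite scale1r.
Qed.

(* The second difference is symmetric in u and v, hence so is the second
   derivative. *)
Lemma second_difference (f : V -> R) (x u v : V) (e : R) : 0 < e ->
  (\forall y \near x, differentiable f y) -> differentiable ('D_u f) x ->
  exists2 d : R, 0 < d & forall h : R, 0 < h < d ->
    `|f (h *: u + (h *: v + x)) - f (h *: u + x) - f (h *: v + x) + f x
        - h ^+ 2 * 'D_v ('D_u f) x| <= e * h ^+ 2.
Proof.
move=> e0 nf dF; set F := 'D_u f in dF *.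
set M := `|u| + `|v| + 1.
have M0 : 0 < M by rewrite /M ltr_wpDl// addr_ge0.
(* Differentiability of F at x. The factor 2 M anticipates that the increments have norm at most h M
   and that two such errors are added. *)
have [d1 d10 Hd1] : exists2 d : R, 0 < d & forall k, `|k| < d ->
    `|F (k + x) - F x - 'd F x k| <= e / (2 * M) * `|k|.
  have := diff_locally dF => /eqaddoP/(_ (e / (2 * M))).
  move=> /(_ _)/nbhs_norm0P[]; first by rewrite divr_gt0// mulr_gt0.
  move=> d d0 Hd; exists d => // k kd.
  have := Hd k kd; rewrite /= => H.
  by rewrite (le_trans _ H)// /(_ \o _) /= -addrA -opprD.
move: nf => /nbhs_normP[d2 d20 Hd2].
exists (Num.min d1 d2 / M); first by rewrite divr_gt0// lt_min d10 d20.
move=> h /andP[h0]; rewrite ltr_pdivlMr// lt_min => /andP[hd1 hd2].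
have small a b : 0 <= a <= h -> 0 <= b <= h -> `|a *: u + b *: v| <= h * M.
  move=> /andP[a0 ah] /andP[b0 bh].
  rewrite (le_trans (ler_normD _ _))// !normrZ !ger0_norm//.
  rewrite /M !mulrDr mulr1 -[leLHS]addr0 lerD ?(ltW h0)//.
  by rewrite lerD// ler_wpM2r.
have hh : 0 <= h <= h by rewrite lexx ltW.
have zh : 0 <= (0:R) <= h by rewrite lexx ltW.
(* The second difference is the increment of phi over [0, h]. The mean value theorem makes it h
   times a difference of two values of F, each then replaced by its linear approximation at x. *)
pose phi (t : R) := f (t *: u + (h *: v + x)) - f (t *: u + x).
have dphi t : 0 <= t <= h -> is_derive t 1 phi
    (F (t *: u + (h *: v + x)) - F (t *: u + x)).
  move=> th; apply: is_deriveB.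
    apply: is_derive_line; apply: Hd2; rewrite /ball_/= addrA opprD addrCA subrr
      addr0.
    by rewrite normrN (le_lt_trans (small _ _ th hh)).
  apply: is_derive_line; apply: Hd2; rewrite /ball_/= opprD addrCA subrr addr0
    normrN.
  by have := small _ _ th zh; rewrite scale0r addr0 => /le_lt_trans; apply.
have cphi : {within `[0, h], continuous phi}.
  apply: derivable_within_continuous => t; rewrite in_itv/= => th.
  by have [] := dphi t th.
have [|c cin cE] := @MVT R phi
  (fun t => F (t *: u + (h *: v + x)) - F (t *: u + x)) 0 h h0 _ cphi.
  by move=> t; rewrite in_itv/= => /andP[t0 th]; apply: dphi; rewrite !ltW.
move: cin; rewrite in_itv/= => /andP[c0 ch].
have -> : f (h *: u + (h *: v + x)) - f (h *: u + x) - f (h *: v + x) + f x =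
    phi h - phi 0 by rewrite /phi !scale0r !add0r; ring.
rewrite cE subr0 [c *: u + (_ + x)]addrA.
have chh : 0 <= c <= h by rewrite !ltW.
have bound a b : 0 <= a <= h -> 0 <= b <= h ->
    `|F (a *: u + b *: v + x) - F x - 'd F x (a *: u + b *: v)| <= e / 2 * h.
  move=> ah bh; apply: le_trans (Hd1 _ _) _.
    rewrite (le_lt_trans (small _ _ ah bh))//.
  have -> : e / 2 * h = e / (2 * M) * (h * M) by field; rewrite gt_eqF.
  by rewrite ler_wpM2l ?small// divr_ge0 ?mulr_ge0// ltW.
have := bound _ _ chh hh; have := bound _ _ chh zh.
have -> : 'd F x (c *: u + h *: v) = 'd F x (c *: u) + h * 'D_v F x.
  by rewrite linearD (linearZ_LR _ h) (deriveE v dF).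
rewrite scale0r addr0.
move: (F _) (F _) (F _) ('d F x _) ('D_v F x) => F1 F2 F3 dFc D A1 A2.
have -> : (F1 - F3) * h - h ^+ 2 * D =
    h * ((F1 - F2 - (dFc + h * D)) - (F3 - F2 - dFc)) by ring.
have -> : e * h ^+ 2 = h * (e / 2 * h + e / 2 * h) by field.
rewrite normrM gtr0_norm// ler_wpM2l ?(ltW h0)//.
by apply: le_trans (ler_normB _ _) _; exact: lerD.
Qed.

(** The second difference is the same for (u, v) and (v, u); comparing both estimates, each with
    error e / 2, and dividing by h^2 bounds the discrepancy by any e > 0. *)
Lemma derive_comm (f : V -> R) (x u v : V) :
  (\forall y \near x, differentiable f y) ->
  differentiable ('D_u f) x -> differentiable ('D_v f) x ->
  'D_v ('D_u f) x = 'D_u ('D_v f) x.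
Proof.
move=> nf du dv; apply/eqP; rewrite -subr_eq0 -normr_le0.
apply/ler_addgt0Pl => e e0; rewrite addr0.
have e20 : 0 < e / 2 by rewrite divr_gt0.
have [d1 d10 H1] := second_difference v e20 nf du.
have [d2 d20 H2] := second_difference u e20 nf dv.
pose h := Num.min d1 d2 / 2.
have m0 : 0 < Num.min d1 d2 by rewrite lt_min d10 d20.
have h0 : 0 < h by rewrite divr_gt0.
have hm : h < Num.min d1 d2 by rewrite ltr_pdivrMr// ltr_pMr// ltr1n.
move: (hm); rewrite lt_min => /andP[hd1 hd2].
have := H1 h; have := H2 h; rewrite h0 hd1 hd2 => /(_ isT) + /(_ isT).
have -> : h *: v + (h *: u + x) = h *: u + (h *: v + x) by rewrite addrCA.
move: (f _) (f _) (f _) (f _) ('D_v _ _) ('D_u _ _) => f1 f2 f3 f4 A B.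
have h20 : 0 < h ^+ 2 by rewrite exprn_gt0.
move=> K1 K2; rewrite -(ler_pM2l h20) -[h ^+ 2 in leLHS]ger0_norm ?(ltW h20)//.
rewrite -normrM.
set X1 := _ - _ in K1; set X2 := _ - _ in K2.
have -> : h ^+ 2 * (A - B) = X1 - X2 by rewrite /X1 /X2; ring.
have -> : h ^+ 2 * e = e / 2 * h ^+ 2 + e / 2 * h ^+ 2 by field.
by apply: le_trans (ler_normB _ _) _; exact: lerD.
Qed.

Lemma derive_row_coord n (f : V -> 'rV[R]_n) x v j : differentiable f x ->
  'D_v f x 0 j = 'D_v (fun y => f y 0 j) x.
Proof. by move=> df; rewrite derive_mx ?mxE//; exact: diff_derivable. Qed.

Lemma derive_comm_row n (f : V -> 'rV[R]_n) (x u v : V) :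
  (\forall y \near x, differentiable f y) ->
  differentiable ('D_u f) x -> differentiable ('D_v f) x ->
  'D_v ('D_u f) x = 'D_u ('D_v f) x.
Proof.
move=> nf du dv; apply/rowP => j.
apply: etrans (derive_row_coord v j du) _.
apply: etrans _ (esym (derive_row_coord u j dv)).
have nd w : \near x, 'D_w (fun y => f y 0 j) x = 'D_w f x 0 j.
  near=> y; apply/esym/derive_row_coord; near: y; exact: nf.
have dc y : differentiable f y -> differentiable (fun z => f z 0 j) y.
  by move=> df; exact: differentiable_comp df (differentiable_coord _ _ _).
have dD w : differentiable ('D_w f) x ->
    differentiable ('D_w (fun y => f y 0 j)) x.
  move=> dw; apply: near_eq_differentiable.
    by near=> y; apply/esym; near: y; exact: nd.
  exact: differentiable_comp dw (differentiable_coord _ _ _).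
apply: etrans (esym (near_eq_derive v (nd u))) _.
apply: etrans _ (near_eq_derive u (nd v)).
apply: derive_comm; [|exact: dD|exact: dD].
by near=> y; apply: dc; near: y.
Unshelve. all: by end_near. Qed.

End Schwarz.

(** * Calculus on manifolds *)

Lemma addrDB (V : zmodType) (a b c : V) : a + c - (b + c) = a - b.
Proof. by rewrite opprD addrACA subrr addr0. Qed.

Section ManifoldCalculus.
Context {R : realType} {n : nat} {M : topologicalType} (A : manifold R n M).
Implicit Types (p q : M) (U : set M) (X Y : vfield R n M) (W : normedModType R).
Implicit Types (m : nat).

Local Notation phi q := (chart_map (chart_at A q)).
Local Notation psi q := (chart_inv (chart_at A q)).
Local Notation dom q := (chart_dom (chart_at A q)).

Lemma near_chart_inv q p (P : set M) : dom q p ->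
  (\forall p' \near p, P p') -> \forall y \near phi q p, P (psi q y).
Proof.
move=> qp nP; have ci : {for phi q p, continuous (psi q)}.
  by apply: chart_inv_continuous; exists p.
by apply: ci; rewrite chart_mapK.
Qed.

Lemma near_dom q p : dom q p -> \forall p' \near p, dom q p'.
Proof. by move=> qp; apply: open_near => //; exact: chart_dom_open. Qed.

Lemma near_cod q p : dom q p ->
  \forall y \near phi q p, (phi q @` dom q) y.
Proof.
by move=> qp; apply: open_near; [exact: chart_cod_open|exists p].
Qed.

Lemma chart_invK q p : dom q p ->
  \forall y \near phi q p, dom q (psi q y) /\ phi q (psi q y) = y.
Proof.
move=> qp; near=> y.
have [p' qp' <-] : (phi q @` dom q) y by near: y; exact: near_cod.
by rewrite chart_mapK.
Unshelve. all: by end_near. Qed.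

Lemma chart_image_open q U : open U -> open (phi q @` (dom q `&` U)).
Proof.
move=> oU; rewrite openE => _ [p [qp Up] <-]; rewrite /interior.
near=> y.
have [qy yE] : dom q (psi q y) /\ phi q (psi q y) = y.
  by near: y; exact: chart_invK.
exists (psi q y) => //; split=> //.
by near: y; apply: near_chart_inv => //; exact: open_near.
Unshelve. all: by end_near. Qed.

Lemma chart_imageP q U y : (phi q @` (dom q `&` U)) y ->
  [/\ dom q (psi q y), U (psi q y) & phi q (psi q y) = y].
Proof. by move=> [p [qp Up] <-]; rewrite chart_mapK. Qed.

Definition smooth_map_on W U (f : M -> W) : Prop :=
  forall q, smooth_on (phi q @` (dom q `&` U)) (f \o psi q).

Definition mdifferentiable W (f : M -> W) p :=
  differentiable (f \o psi p) (phi p p).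

Lemma smooth_differentiable W U (f : M -> W) p q : smooth_map_on U f -> U p ->
  dom q p -> differentiable (f \o psi q) (phi q p).
Proof. by move=> /(_ q 1%N)[+ _] Up qp; apply; exists p. Qed.

Lemma smooth_mdifferentiable W U (f : M -> W) p : smooth_map_on U f -> U p ->
  mdifferentiable f p.
Proof. by move=> sf Up; apply: (smooth_differentiable sf) => //;
  exact: mem_chart_at. Qed.

Lemma smooth_on_derive (V : normedModType R) W (S : set V) (f : V -> W) v :
  smooth_on S f -> smooth_on S ('D_v f).
Proof. by move=> sf k; have [_] := sf k.+1; apply. Qed.

Lemma smooth_map_chart q : smooth_map_on (dom q) (phi q).
Proof. by move=> p; exact: chart_compatible. Qed.

Lemma smooth_map_sub W U U' (f : M -> W) :
  U' `<=` U -> smooth_map_on U f -> smooth_map_on U' f.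
Proof.
move=> UU sf q k; apply: times_differentiable_sub (sf q k).
by apply: image_subset => p [qp /UU].
Qed.

Lemma eq_smooth_map W U (f g : M -> W) : open U -> (forall p,
  U p -> f p = g p) ->
  smooth_map_on U f -> smooth_map_on U g.
Proof.
move=> oU fg sf q k; apply: (eq_times_differentiable _ _ (sf q k)).
  exact: chart_image_open.
by move=> y /chart_imageP[_ Uy _]; exact: fg.
Qed.

(** [times_differentiable] puts pointwise conditions on total functions, so it may be checked one
    point at a time. *)
Lemma times_differentiable_local (V : normedModType R) W k (S : set V) (f : V ->
  W) :
  (forall x, S x -> times_differentiable k [set x] f) <-> times_differentiable k
    S f.
Proof.
split.
  elim: k f => //= k IH f Hf; split=> [x Sx|v].
    by have [+ _] := Hf x Sx; apply.
  by apply: IH => x Sx; have [_] := Hf x Sx; apply.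
by move=> Hf x Sx; apply: times_differentiable_sub Hf => _ ->.
Qed.

Lemma smooth_map_local W U (f : M -> W) :
  (forall p, U p -> exists U', U' p /\ smooth_map_on U' f) -> smooth_map_on U f.
Proof.
move=> Hf q k; apply/times_differentiable_local => y yU.
have [qy Uy yE] := chart_imageP yU.
have [U' [U'y sf]] := Hf _ Uy.
apply: times_differentiable_sub (sf q k) => _ ->.
by exists (psi q y).
Qed.

Section Open.
Variables (W : normedModType R) (U : set M).
Hypothesis oU : open U.

Lemma smooth_map_cst (c : W) : smooth_map_on U (fun=> c).
Proof. by move=> q k; exact: times_differentiable_cst. Qed.

Lemma smooth_mapD (f g : M -> W) : smooth_map_on U f -> smooth_map_on U g ->
  smooth_map_on U (fun p => f p + g p).
Proof.
move=> sf sg q k; apply: (times_differentiableD _ (sf q k) (sg q k)).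
exact: chart_image_open.
Qed.

Lemma smooth_map_scale (f : M -> R) (g : M -> W) :
  smooth_map_on U f -> smooth_map_on U g -> smooth_map_on U (fun p => f p *: g
    p).
Proof.
move=> sf sg q k; apply: (times_differentiable_scale _ (sf q k) (sg q k)).
exact: chart_image_open.
Qed.

Lemma smooth_mapN (f : M -> W) : smooth_map_on U f ->
  smooth_map_on U (fun p => - f p).
Proof.
move=> sf; have -> : (fun p => - f p) = (fun p => (-1) *: f p).
  by apply/funext => p; rewrite scaleN1r.
apply: smooth_map_scale => // q k; exact: times_differentiable_cst.
Qed.

Lemma smooth_map_sum (I : Type) (r : seq I) (P : pred I) (f : I -> M -> W) :
  (forall i, P i -> smooth_map_on U (f i)) ->
  smooth_map_on U (fun p => \sum_(i <- r | P i) f i p).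
Proof.
move=> sf q k; apply: (@times_differentiable_sum _ _ _ _ _ _ _ _ (fun i => f i
  \o psi q)).
  exact: chart_image_open.
by move=> i Pi; exact: sf.
Qed.

End Open.

Lemma smooth_map_coord m1 m2 U (f : M -> 'M[R]_(m1, m2)) i j : open U ->
  smooth_map_on U f -> smooth_map_on U (fun p => f p i j).
Proof.
move=> oU sf q k; apply: (times_differentiable_coord _ _ _ (sf q k)).
exact: chart_image_open.
Qed.

Lemma smooth_map_rV m U (f : M -> 'rV[R]_m) : open U ->
  (forall j, smooth_map_on U (fun p => f p 0 j)) -> smooth_map_on U f.
Proof.
move=> oU sf q k; apply: times_differentiable_rV => [|j].
  exact: chart_image_open.
exact: sf.
Qed.

Lemma smooth_map_inv U (f : M -> R) : open U -> (forall p, U p -> f p != 0) ->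
  smooth_map_on U f -> smooth_map_on U (fun p => (f p)^-1).
Proof.
move=> oU f0 sf q k; apply: (times_differentiable_inv _ _ (sf q k)).
  exact: chart_image_open.
by move=> y /chart_imageP[_ Uy _]; exact: f0.
Qed.

Lemma smooth_vfieldS U X : smooth_vfield A X -> smooth_vfield_on A U X.
Proof.
move=> sX q k; apply: times_differentiable_sub (sX q k).
by apply: image_subset => p [].
Qed.

Lemma near_eq_act W X (f g : M -> W) p : (\near p, f p = g p) ->
  act A X f p = act A X g p.
Proof.
move=> fg; apply: near_eq_derive.
by apply: (near_chart_inv (P := fun p => f p = g p)) => //; exact: mem_chart_at.
Qed.

Lemma eq_act W X Y (f : M -> W) p : X p = Y p -> act A X f p = act A Y f p.
Proof. by rewrite /act => ->. Qed.

Lemma act_change_chart W X (f : M -> W) p q : dom q p ->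
  differentiable (f \o psi q) (phi q p) ->
  mdifferentiable f p /\
  act A X f p = 'D_(act A X (phi q) p) (f \o psi q) (phi q p).
Proof.
move=> qp df; have pp := mem_chart_at A p.
have dt : differentiable (phi q \o psi p) (phi p p).
  by have [+ _] := chart_compatible A p q 1; apply; exists p.
have eqp : (phi q \o psi p) (phi p p) = phi q p by rewrite /= chart_mapK.
have nE : \forall y \near phi p p,
    ((f \o psi q) \o (phi q \o psi p)) y = (f \o psi p) y.
  near=> y; rewrite /= chart_mapK//; near: y.
  by apply: (near_chart_inv (P := dom q)) => //; exact: near_dom.
have df' : differentiable (f \o psi q) ((phi q \o psi p) (phi p p)) by rewrite
  eqp.
have dc := differentiable_comp dt df'.
split; first exact: near_eq_differentiable nE dc.
rewrite /act -(near_eq_derive _ nE) (deriveE _ dc) (diff_comp dt df') /=.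
by rewrite -(deriveE (X p) dt) chart_mapK// (deriveE _ df).
Unshelve. all: by end_near. Qed.

Lemma act_chart X p : act A X (phi p) p = X p.
Proof.
rewrite /act -[RHS](derive_id (phi p p) (X p)); apply: near_eq_derive.
near=> y; rewrite /=.
by have [] : dom p (psi p y) /\ phi p (psi p y) = y
  by near: y; apply: chart_invK; exact: mem_chart_at.
Unshelve. all: by end_near. Qed.

Lemma actD W X (f g : M -> W) p : mdifferentiable f p -> mdifferentiable g p ->
  act A X (fun q => f q + g q) p = act A X f p + act A X g p.
Proof.
move=> df dg; rewrite /act.
by apply: (@deriveD _ _ _ (f \o psi p) (g \o psi p)); apply: diff_derivable.
Qed.

Lemma act_scale W X (f : M -> R) (g : M -> W) p :
  mdifferentiable f p -> mdifferentiable g p ->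
  act A X (fun q => f q *: g q) p = act A X f p *: g p + f p *: act A X g p.
Proof.
move=> df dg; have pp := mem_chart_at A p; rewrite /act.
have [_ H] := differentiable_scale df dg.
by rewrite -[LHS]/('D_(X p) (fun y => (f \o psi p) y *: (g \o psi p) y) (phi p
  p))
  H /= chart_mapK.
Qed.

Lemma act_cst W X (c : W) p : act A X (fun=> c) p = 0.
Proof. exact: derive_cst. Qed.

Lemma actN W X (f : M -> W) p : mdifferentiable f p ->
  act A X (fun q => - f q) p = - act A X f p.
Proof.
move=> df; rewrite /act; apply: (@deriveN _ _ _ (f \o psi p)).
exact: diff_derivable.
Qed.

Lemma act_sum W X (I : Type) (r : seq I) (f : I -> M -> W) p :
  (forall i, mdifferentiable (f i) p) ->
  act A X (fun q => \sum_(i <- r) f i q) p = \sum_(i <- r) act A X (f i) p.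
Proof.
move=> df.
suff [] : mdifferentiable (fun q => \sum_(i <- r) f i q) p /\
    act A X (fun q => \sum_(i <- r) f i q) p = \sum_(i <- r) act A X (f i) p by
      [].
elim: r => [|i r [IHd IH]].
  have -> : (fun q => \sum_(i <- [::]) f i q) = (fun=> 0).
    by apply/funext => q; rewrite big_nil.
  rewrite big_nil act_cst; split=> //; exact: differentiable_cst.
have -> : (fun q => \sum_(k <- i :: r) f k q) =
    (fun q => f i q + \sum_(k <- r) f k q).
  by apply/funext => q; rewrite big_cons.
split; first exact: (differentiableD (df i) IHd).
by rewrite big_cons actD// IH.
Qed.

Lemma act_coord X m (f : M -> 'rV[R]_m) p j : mdifferentiable f p ->
  act A X f p 0 j = act A X (fun q => f q 0 j) p.
Proof. by move=> df; rewrite /act derive_row_coord. Qed.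

Lemma act_lin W X (f : M -> W) p : mdifferentiable f p ->
  act A X f p = 'd (f \o psi p) (phi p p) (X p).
Proof. by move=> df; rewrite /act (deriveE _ df). Qed.

Lemma derive_sum_coord W (h : 'rV[R]_n -> W) y v : differentiable h y ->
  'D_v h y = \sum_j v 0 j *: 'D_(delta_mx 0 j) h y.
Proof.
move=> dh; rewrite (deriveE _ dh) {1}(row_sum_delta v) linear_sum.
by apply: eq_bigr => j _; rewrite linearZ/= (deriveE _ dh).
Qed.

Lemma mdifferentiable_cst W (c : W) p : mdifferentiable (fun=> c) p.
Proof. exact: differentiable_cst. Qed.

Lemma mdifferentiableN W (f : M -> W) p : mdifferentiable f p ->
  mdifferentiable (fun q => - f q) p.
Proof. by move=> df; exact: (differentiableN df). Qed.

Lemma mdifferentiable_scale W (f : M -> R) (g : M -> W) p :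
  mdifferentiable f p -> mdifferentiable g p ->
  mdifferentiable (fun q => f q *: g q) p.
Proof. by move=> df dg; exact: (differentiable_scale df dg).1. Qed.

Lemma act_scaler W X k (g : M -> W) p : mdifferentiable g p ->
  act A X (fun q => k *: g q) p = k *: act A X g p.
Proof.
move=> dg; have := act_scale X (mdifferentiable_cst k p) dg.
by rewrite act_cst scale0r add0r.
Qed.

Lemma act_linear W X Y Z (f : M -> W) k p : mdifferentiable f p ->
  Z p = k *: X p + Y p -> act A Z f p = k *: act A X f p + act A Y f p.
Proof. by move=> df Zp; rewrite !(act_lin _ df) Zp linearP. Qed.

Lemma bracket_chart X Y p : bracket A X Y p =
  act A X (act A Y (phi p)) p - act A Y (act A X (phi p)) p.
Proof. by []. Qed.

Lemma act_in_chart W X U (f : M -> W) q y : smooth_map_on U f ->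
  (phi q @` (dom q `&` U)) y ->
  act A X f (psi q y) =
  \sum_j act A X (phi q) (psi q y) 0 j *: 'D_(delta_mx 0 j) (f \o psi q) y.
Proof.
move=> sf yU; have [qy Uy yE] := chart_imageP yU.
have df := smooth_differentiable sf Uy qy.
have [_ ->] := act_change_chart X qy df.
by rewrite (derive_sum_coord _ df) yE.
Qed.

Lemma smooth_map_act W X U (f : M -> W) : open U -> smooth_vfield_on A U X ->
  smooth_map_on U f -> smooth_map_on U (act A X f).
Proof.
move=> oU sX sf q k; have oi : open (phi q @` (dom q `&` U)) := chart_image_open
  oU.
apply: (@eq_times_differentiable _ _ _ _ _ (fun y =>
  \sum_j act A X (phi q) (psi q y) 0 j *: 'D_(delta_mx 0 j) (f \o psi q) y) _
    oi).
  by move=> y yU; rewrite /= (act_in_chart _ sf yU).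
apply: times_differentiable_sum => // j _.
apply: times_differentiable_scale => //; last exact: smooth_on_derive (sf q) k.
apply: (times_differentiable_coord _ _ oi (sX q k)).
Qed.

(** A first-order term plus a Hessian term. By Schwarz the latter is symmetric in X and Y, so that
    it drops out of brackets. *)
Lemma act_act m X Y U (f : M -> 'rV[R]_m) p : open U -> U p ->
  smooth_vfield_on A U Y -> smooth_map_on U f ->
  act A X (act A Y f) p =
    'D_(act A X (act A Y (phi p)) p) (f \o psi p) (phi p p) +
    'D_(Y p) ('D_(X p) (f \o psi p)) (phi p p).
Proof.
move=> oU Up sY sf; have pp := mem_chart_at A p.
set F := f \o psi p; set x0 := phi p p.
have x0U : (phi p @` (dom p `&` U)) x0 by exists p.
have oi : open (phi p @` (dom p `&` U)) := chart_image_open oU.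
have dF := smooth_differentiable sf Up pp.
pose eta := act A Y (phi p) \o psi p.
have deta : differentiable eta x0 by have [+ _] := sY p 1; apply.
have detaj j : differentiable (fun y => eta y 0 j) x0.
  exact: differentiable_comp deta (differentiable_coord _ _ _).
have dDF v : differentiable ('D_v F) x0.
  by have [+ _] := smooth_on_derive v (sf p) 1%N; apply.
have nE : \forall y \near x0,
    (act A Y f \o psi p) y = \sum_j eta y 0 j *: 'D_(delta_mx 0 j) F y.
  near=> y; have yU : (phi p @` (dom p `&` U)) y by near: y;
    exact: (open_near oi x0U).
  by rewrite /= (act_in_chart _ sf).
rewrite {1}/act (near_eq_derive _ nE).
have -> : (fun y => \sum_j eta y 0 j *: 'D_(delta_mx 0 j) F y) =
    \sum_j (fun y => eta y 0 j *: 'D_(delta_mx 0 j) F y).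
  by apply/funext => y; rewrite fct_sumE.
rewrite derive_sum => [|j]; last first.
  by apply: diff_derivable; have [] := differentiable_scale (detaj j) (dDF
    (delta_mx 0 j)).
under eq_bigr => j _.
  have [_ ->] := differentiable_scale (detaj j) (dDF (delta_mx 0 j)).
  rewrite -(derive_row_coord _ _ deta).
over.
rewrite big_split /=; congr (_ + _).
  by rewrite -(derive_sum_coord _ dF).
rewrite [RHS](derive_sum_coord _ (dDF _)); apply: eq_bigr => j _.
have -> : eta x0 = Y p by rewrite /eta/= chart_mapK// act_chart.
have nF : \forall y \near x0, differentiable F y.
  by near=> y; have [+ _] := sf p 1; apply; near: y; exact: (open_near oi x0U).
by rewrite (derive_comm_row nF (dDF _) (dDF _)).
Unshelve. all: by end_near. Qed.

(** [bracket] is defined through the coordinate functions of a single chart; the cancellation of the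
    Hessian terms makes it act as the commutator on every smooth map. *)
Lemma bracketE m X Y U (f : M -> 'rV[R]_m) p : open U -> U p ->
  smooth_vfield_on A U X -> smooth_vfield_on A U Y -> smooth_map_on U f ->
  act A (bracket A X Y) f p = act A X (act A Y f) p - act A Y (act A X f) p.
Proof.
move=> oU Up sX sY sf; have pp := mem_chart_at A p.
have dF := smooth_differentiable sf Up pp.
have dDF v : differentiable ('D_v (f \o psi p)) (phi p p).
  by have [+ _] := smooth_on_derive v (sf p) 1%N; apply; exists p.
have nF : \forall y \near phi p p, differentiable (f \o psi p) y.
  have oi : open (phi p @` (dom p `&` U)) := chart_image_open oU.
  have x0U : (phi p @` (dom p `&` U)) (phi p p) by exists p.
  by near=> y; have [+ _] := sf p 1; apply; near: y; exact: (open_near oi x0U).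
have -> : act A (bracket A X Y) f p =
    'D_(act A X (act A Y (phi p)) p) (f \o psi p) (phi p p) -
    'D_(act A Y (act A X (phi p)) p) (f \o psi p) (phi p p).
  apply: etrans (deriveE (bracket A X Y p) dF) _.
  apply: etrans _ (esym (congr2 (fun a b => a - b) (deriveE _ dF) (deriveE _
    dF))).
  exact: linearB.
apply/esym; apply: etrans (congr2 (fun a b => a - b)
  (act_act X oU Up sY sf) (act_act Y oU Up sX sf)) _.
rewrite (derive_comm_row nF (dDF (X p)) (dDF (Y p))).
exact: addrDB.
Unshelve. all: by end_near. Qed.

End ManifoldCalculus.

(** * Left-invariant vector fields *)

Section LieGroupCalculus.
Context {R : realType} {n : nat} {G : groupTopologicalType} (L : lie_group R n
  G).
Implicit Types (a b p q : G) (X Y Z : vfield R n G) (v : 'rV[R]_n).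

Local Notation phi q := (chart_map (chart_at L q)).
Local Notation psi q := (chart_inv (chart_at L q)).
Local Notation dom q := (chart_dom (chart_at L q)).
Local Notation "''L_' a" := (left_translation a) (at level 8, a at level 2).

Lemma left_translation_continuous a : continuous 'L_a.
Proof.
move=> p; have pair_cvg : (a, x) @[x --> p] --> (a, p).
  by apply: cvg_pair; [exact: cvg_cst|exact: cvg_id].
exact: cvg_comp pair_cvg (@lie_mul_continuous _ _ _ L (a, p)).
Qed.

Lemma open_left_translation a (U : set G) : open U -> open ('L_a @^-1` U).
Proof. by move=> oU; apply: open_comp => // p _; exact:
  left_translation_continuous. Qed.

(** In charts this is the multiplication restricted to the slice through a, that is, composed with
    the affine map y |-> (phi a a, y). *)
Lemma smooth_left_translation a c :
  smooth_map_on L ('L_a @^-1` dom c) (phi c \o 'L_a).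
Proof.
move=> q k.
have aa : psi a (phi a a) = a by apply: chart_mapK; exact: mem_chart_at.
have := @times_differentiable_comp_affine R 'rV_n ('rV_n * 'rV_n)%type 'rV_n k
  (phi q @` (dom q `&` 'L_a @^-1` dom c)) _ _ (fun y => (phi a a, y))
  (fun y => (0, y)) _ _ _ (lie_mul_smooth L a q c k).
have oU : open (phi q @` (dom q `&` 'L_a @^-1` dom c)).
  by apply: chart_image_open; apply: open_left_translation;
    exact: chart_dom_open.
move=> H; apply: eq_times_differentiable (H _ _ _) => //.
- by move=> y _ /=; rewrite aa.
- move=> y yU; have [qy cy yE] := chart_imageP yU.
  split=> /=; first by exists a => //; exact: mem_chart_at.
    by exists (psi q y).
  by rewrite aa.
Qed.

Lemma act_left_translation (W : normedModType R) X (f : G -> W) a p :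
  mdifferentiable L f (a * p)%g ->
  mdifferentiable L (f \o 'L_a) p /\
  act L X (f \o 'L_a) p =
    'D_(tangent_map L 'L_a p (X p)) (f \o psi (a * p)%g) (phi (a * p)%g (a *
      p)%g).
Proof.
move=> df; have pp := mem_chart_at L p.
set c := (a * p)%g in df *; have cc := mem_chart_at L c.
have dt : differentiable ((phi c \o 'L_a) \o psi p) (phi p p).
  exact: (smooth_differentiable (smooth_left_translation a c) cc pp).
have tE : ((phi c \o 'L_a) \o psi p) (phi p p) = phi c c by rewrite /=
  chart_mapK.
have nE : \forall y \near phi p p,
    ((f \o psi c) \o ((phi c \o 'L_a) \o psi p)) y = ((f \o 'L_a) \o psi p) y.
  near=> y; rewrite /= chart_mapK//; near: y.
  apply: (near_chart_inv (P := 'L_a @^-1` dom c)) => //.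
  by apply: open_near => //; apply: open_left_translation;
    exact: chart_dom_open.
have df' : differentiable (f \o psi c) (((phi c \o 'L_a) \o psi p) (phi p p)).
  by rewrite tE.
have dc := differentiable_comp dt df'.
split; first exact: near_eq_differentiable nE dc.
rewrite /act -(near_eq_derive _ nE) (deriveE _ dc) (diff_comp dt df') /=.
by rewrite (chart_mapK pp) (deriveE _ df) /tangent_map (deriveE _ dt).
Unshelve. all: by end_near. Qed.

Lemma act_left_invariant (W : normedModType R) X (f : G -> W) a p :
  lie_algebra L X -> mdifferentiable L f (a * p)%g ->
  act L X (f \o 'L_a) p = act L X f (a * p)%g.
Proof. by move=> [_ XL] df; have [_ ->] := act_left_translation X df;
  rewrite XL. Qed.

Lemma tangent_map_act a p v :
  tangent_map L 'L_a p v = act L (fun=> v) (phi (a * p)%g \o 'L_a) p.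
Proof. by []. Qed.

Lemma tangent_map_differentiable a p :
  differentiable ((phi (a * p)%g \o 'L_a) \o psi p) (phi p p).
Proof.
exact: (smooth_differentiable (smooth_left_translation a (a * p)%g)
  (mem_chart_at L _) (mem_chart_at L _)).
Qed.

Definition lifield v : vfield R n G := fun a => tangent_map L 'L_a 1%g v.

Lemma lifield_linear k u v a : lifield (k *: u + v) a = k *: lifield u a +
  lifield v a.
Proof.
rewrite /lifield /tangent_map !(deriveE _ (tangent_map_differentiable _ _)).
exact: linearP.
Qed.

Lemma act_lifield (W : normedModType R) v (f : G -> W) a : mdifferentiable L f a
  ->
  act L (lifield v) f a = act L (fun=> v) (f \o 'L_a) 1%g.
Proof.
move=> df; have := @act_left_translation W (fun=> v) f a 1%g.
by rewrite mulg1 => /(_ df)[_ ->].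
Qed.

Lemma lifield_left_invariant v a p :
  tangent_map L 'L_a p (lifield v p) = lifield v (a * p)%g.
Proof.
have dfp : mdifferentiable L (phi (a * p)%g \o 'L_a) p.
  exact: tangent_map_differentiable.
apply: etrans (@eq_act _ _ _ _ _ _ (lifield v) _ _ erefl) _.
apply: etrans (act_lifield v dfp) _.
have E : (phi (a * p)%g \o 'L_a) \o 'L_p = phi (a * p * 1)%g \o 'L_(a * p)%g.
  by apply/funext => q; rewrite /= /left_translation mulgA mulg1.
by rewrite /lifield tangent_map_act E.
Qed.

(** In the chart q, the components of [lifield v] at y are the derivative of the multiplication at
    (y, z0) along (0, v), with z0 the coordinates of the unit. They are smooth in y because the
    multiplication is jointly smooth. *)
Lemma lifield_smooth v : smooth_vfield L (lifield v).
Proof.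
move=> q k.
pose F (y : 'rV[R]_n * 'rV[R]_n) := phi q (psi q y.1 * psi 1%g y.2)%g.
set z0 := phi 1%g 1%g.
have z01 : psi 1%g z0 = 1%g by apply: chart_mapK; exact: mem_chart_at.
have sF := smooth_on_derive (0, v) (lie_mul_smooth L q 1%g q).
have Sy y : (phi q @` (dom q `&` setT)) y ->
   [set y : 'rV[R]_n * 'rV[R]_n |
        [/\ (phi q @` dom q) y.1, (phi 1%g @` dom 1%g) y.2 &
            dom q (psi q y.1 * psi 1%g y.2)%g]] (y, z0).
  move=> /chart_imageP[qy _ yE]; split=> /=; first by exists (psi q y).
    by exists 1%g => //; exact: mem_chart_at.
  by rewrite z01 mulg1.
have H := @times_differentiable_comp_affine R 'rV_n ('rV_n * 'rV_n)%type 'rV_n k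
  (phi q @` (dom q `&` setT)) _ _ (fun y => (y, z0)) (fun y => (y, 0))
  _ _ Sy (sF k).
have oU : open (phi q @` (dom q `&` setT)).
  by apply: chart_image_open; exact: openT.
apply: eq_times_differentiable (H _ _) => //.
move=> y yU; have [qy _ yE] := chart_imageP yU; rewrite /=.
have dq : mdifferentiable L (phi q) (psi q y).
  by apply: smooth_mdifferentiable (smooth_map_chart _ _) _.
rewrite act_lifield// /act.
have dF : differentiable F (y, z0).
  by have [+ _] := lie_mul_smooth L q 1%g q 1; apply; exact: Sy.
pose l (z : 'rV[R]_n) := (y, z).
have dl : is_diff z0 l (fun z => (0, z)).
  exact: (is_diff_pair (is_diff_cst _ z0) (is_diff_id z0)).
have dlz : differentiable l z0 by apply: ex_diff.
have dlE : 'd l z0 = (fun z => (0, z)) :> ('rV_n -> _) by apply: diff_val.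
rewrite -[RHS]/('D_v (F \o l) z0) (deriveE _ (differentiable_comp dlz dF)).
by rewrite (diff_comp dlz dF) /= dlE (deriveE _ dF).
Qed.

Lemma lifield_lie v : lie_algebra L (lifield v).
Proof. by split; [exact: lifield_smooth|exact: lifield_left_invariant]. Qed.

Lemma lie_algebraE X : lie_algebra L X -> X = lifield (X 1%g).
Proof. by move=> [_ XL]; apply/funext => a; rewrite /lifield XL
  /left_translation mulg1. Qed.

Lemma smooth_bracket X Y : smooth_vfield L X -> smooth_vfield L Y ->
  smooth_vfield L (bracket L X Y).
Proof.
move=> sX sY q; have oq : open (dom q) := chart_dom_open _.
have sq := smooth_map_chart L q.
have sXY := smooth_map_act oq (smooth_vfieldS _ sX)
  (smooth_map_act oq (smooth_vfieldS _ sY) sq).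
have sYX := smooth_map_act oq (smooth_vfieldS _ sY)
  (smooth_map_act oq (smooth_vfieldS _ sX) sq).
have s := smooth_mapD oq sXY (smooth_mapN oq sYX).
have := s q; rewrite setIid => s' k.
rewrite setIT; apply: eq_times_differentiable (s' k).
  exact: chart_cod_open.
move=> y [p qp <-]; rewrite /= chart_mapK//; apply/esym.
exact: (bracketE oq qp (smooth_vfieldS _ sX) (smooth_vfieldS _ sY) sq).
Qed.

(** The tangent map of the translation by a is the action on the chart map composed with that
    translation. There [bracketE] writes the bracket as a commutator, and the action of a
    left-invariant field commutes with composition by the translation. *)
Lemma bracket_lie X Y : lie_algebra L X -> lie_algebra L Y ->
  lie_algebra L (bracket L X Y).
Proof.
move=> LX LY; have [sX XL] := LX; have [sY YL] := LY.
split=> [|a p]; first exact: smooth_bracket.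
set c := (a * p)%g; set U := 'L_a @^-1` dom c.
have oU : open U by apply: open_left_translation; exact: chart_dom_open.
have Up : U p by exact: (mem_chart_at L c).
have oc : open (dom c) := chart_dom_open _.
have sc := smooth_map_chart L c.
have -> : tangent_map L 'L_a p (bracket L X Y p) =
  act L (bracket L X Y) (phi c \o 'L_a) p by [].
rewrite (bracketE oU Up (smooth_vfieldS _ sX) (smooth_vfieldS _ sY)
  (smooth_left_translation a c)).
have actU Z : lie_algebra L Z ->
    \forall q \near p, act L Z (phi c \o 'L_a) q = (act L Z (phi c) \o 'L_a) q.
  move=> LZ; near=> q; apply: act_left_invariant => //.
  by apply: smooth_mdifferentiable sc _; near: q; exact: open_near.
have dc Z : smooth_vfield L Z -> mdifferentiable L (act L Z (phi c)) c.
  move=> sZ; apply: smooth_mdifferentiable (mem_chart_at L c).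
  exact: smooth_map_act (smooth_vfieldS _ sZ) sc.
rewrite (near_eq_act L X (actU Y LY)) (near_eq_act L Y (actU X LX)).
by rewrite (act_left_invariant LX (dc _ sY)) (act_left_invariant LY (dc _ sX)).
Unshelve. all: by end_near. Qed.

End LieGroupCalculus.

(** * The Jacobi identity for vector fields *)

Section Jacobi.
Context {R : realType} {n : nat} {M : topologicalType} (A : manifold R n M).
Implicit Types (X Y Z : vfield R n M).

Lemma alternating_sum_eq0 m (a b c d e f : 'rV[R]_m) :
  (a - b - (c - d)) + (c - e - (f - b)) + (f - d - (a - e)) = 0.
Proof.
apply/rowP => i; have -> : (0 : 'rV[R]_m) 0 i = 0 by rewrite mxE.
by rewrite !(addmxE, oppmxE); ring.
Qed.

Lemma bracketC X Y : bracket A Y X = - bracket A X Y.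
Proof. by apply/funext => p; rewrite opprfctE !bracket_chart opprB. Qed.

Lemma mdifferentiable_act_chart X p : smooth_vfield_on A (chart_dom (chart_at A
  p)) X ->
  mdifferentiable A (act A X (chart_map (chart_at A p))) p.
Proof.
move=> sX; apply: smooth_mdifferentiable (mem_chart_at A p).
exact: smooth_map_act (chart_dom_open _) sX (smooth_map_chart A p).
Qed.

Lemma bracket_jacobi X Y Z p :
  smooth_vfield A X -> smooth_vfield A Y -> smooth_vfield A Z ->
  bracket A X (bracket A Y Z) p + bracket A Y (bracket A Z X) p +
  bracket A Z (bracket A X Y) p = 0.
Proof.
pose U := chart_dom (chart_at A p); pose f := chart_map (chart_at A p).
have oU : open U := chart_dom_open _.
have Up : U p := mem_chart_at A p.
have sf : smooth_map_on A U f := smooth_map_chart A p.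
have nU : \forall q \near p, U q := open_near oU Up.
(* Each double bracket expands into four triple derivatives of f; over the cyclic sum they cancel in
   pairs. *)
suff E X' Y' Z' : smooth_vfield A X' -> smooth_vfield A Y' -> smooth_vfield A Z'
  ->
  bracket A X' (bracket A Y' Z') p =
  act A X' (act A Y' (act A Z' f)) p - act A X' (act A Z' (act A Y' f)) p -
  (act A Y' (act A Z' (act A X' f)) p - act A Z' (act A Y' (act A X' f)) p).
  by move=> sX sY sZ; rewrite !E//; exact: alternating_sum_eq0.
move=> /(smooth_vfieldS U) sX /(smooth_vfieldS U) sY /(smooth_vfieldS U) sZ.
have s1 V : smooth_vfield_on A U V -> smooth_map_on A U (act A V f).
  by move=> sV; exact: (smooth_map_act oU sV sf).
have d2 V W : smooth_vfield_on A U V -> smooth_vfield_on A U W ->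
    mdifferentiable A (act A V (act A W f)) p.
  by move=> sV sW; exact: (smooth_mdifferentiable (smooth_map_act oU sV (s1 _
    sW)) Up).
rewrite bracket_chart (bracketE oU Up sY sZ (s1 _ sX)); congr (_ - _).
have nE : \forall q \near p, act A (bracket A Y' Z') f q =
    act A Y' (act A Z' f) q + - act A Z' (act A Y' f) q.
  by near=> q; apply: (bracketE oU _ sY sZ sf); near: q.
have dYZ := d2 _ _ sY sZ; have dZY := d2 _ _ sZ sY.
apply: etrans (near_eq_act A X' nE) _.
apply: etrans (actD X' dYZ (mdifferentiableN dZY)) _.
exact: congr1 (actN X' dZY).
Unshelve. all: by end_near. Qed.

End Jacobi.

(** * The Lie bracket on the tangent space at the unit *)

Section LieBracket.
Context {R : realType} {n : nat} {G : groupTopologicalType} (L : lie_group R n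
  G).
Implicit Types (u v w : 'rV[R]_n).

Definition lbracket u v := bracket L (lifield L u) (lifield L v) 1%g.

Lemma bracket_lifield u v :
  bracket L (lifield L u) (lifield L v) = lifield L (lbracket u v).
Proof. by apply: lie_algebraE; apply: bracket_lie; exact: lifield_lie. Qed.

Lemma lbracketC u v : lbracket v u = - lbracket u v.
Proof. exact: (congr1 (fun X : vfield R n G => X 1%g) (bracketC _ _ _)). Qed.

Lemma lbracket_linearl k u v w :
  lbracket (k *: u + v) w = k *: lbracket u w + lbracket v w.
Proof.
pose f := chart_map (chart_at L 1%g).
have sv x := smooth_vfieldS (chart_dom (chart_at L 1%g)) (lifield_smooth L x).
have d x := mdifferentiable_act_chart (sv x).
have E x y : lbracket x y = act L (lifield L x) (act L (lifield L y) f) 1%g -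
    act L (lifield L y) (act L (lifield L x) f) 1%g by exact: bracket_chart.
have nE : \forall q \near 1%g, act L (lifield L (k *: u + v)) f q =
    k *: act L (lifield L u) f q + act L (lifield L v) f q.
  near=> q; have Uq : chart_dom (chart_at L 1%g) q.
    by near: q; exact: open_near (chart_dom_open _) (mem_chart_at _ _).
  have df := smooth_mdifferentiable (smooth_map_chart L 1%g) Uq.
  exact: (act_linear df (lifield_linear L k u v q)).
have dc := mdifferentiable_cst L (k : R) 1%g.
have dk := mdifferentiable_scale dc (d u).
have E1 := act_linear (d w) (lifield_linear L k u v 1%g).
have E2 := near_eq_act L (lifield L w) nE.
have E3 := actD (lifield L w) dk (d v).
have E4 := act_scale (lifield L w) dc (d u).
have fin (a b c e x z t : 'rV[R]_n) (y : R) : z = k *: a + b -> y = 0 ->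
    t = (y *: x + k *: c) + e -> z - t = k *: (a - c) + (b - e).
  by move=> -> -> ->; rewrite scale0r add0r scalerBr opprD addrACA.
apply: etrans (E _ _) _.
apply: etrans _ (esym (congr2 (fun a b => k *: a + b) (E u w) (E v w))).
exact: (fin _ _ _ _ _ _ _ _ E1 (act_cst L _ k _)
  (etrans E2 (etrans E3 (congr1 (fun z => z + _) E4)))).
Unshelve. all: by end_near. Qed.

Lemma lbracket_jacobi u v w : lbracket u (lbracket v w) +
  lbracket v (lbracket w u) + lbracket w (lbracket u v) = 0.
Proof.
have E x y z : lbracket x (lbracket y z) =
    bracket L (lifield L x) (bracket L (lifield L y) (lifield L z)) 1%g.
  exact: (congr1 (fun V => bracket L (lifield L x) V 1%g) (esym (bracket_lifield
    y z))).
apply: etrans (congr2 +%R (congr2 +%R (E u v w) (E v w u)) (E w u v)) _.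
exact: (bracket_jacobi 1%g
  (lifield_smooth L u) (lifield_smooth L v) (lifield_smooth L w)).
Qed.

End LieBracket.

(** * Projections and frames *)

Lemma span_enumP (K : fieldType) (vT : vectType K) k (X : 'I_k -> vT) v :
  v \in <<[seq X i | i <- enum 'I_k]>>%VS <->
  exists c : 'rV[K]_k, v = \sum_i c 0 i *: X i.
Proof.
pose T : k.-tuple vT := [tuple X i | i < k].
rewrite -[map _ _]/(T : seq vT).
have TX (i : 'I_k) : T`_i = X i by rewrite -tnth_nth tnth_mktuple.
split=> [/coord_span vE|[c ->]].
  exists (\row_i coord T i v); rewrite {1}vE; apply: eq_bigr => i _.
  by rewrite mxE TX.
apply: memv_suml => i _; apply: memvZ; apply: memv_span.
by rewrite -TX mem_nth// size_tuple.
Qed.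

Lemma basis_of_enumP (K : fieldType) (vT : vectType K) k (X : 'I_k -> vT)
    (U : {vspace vT}) :
  basis_of U [seq X i | i <- enum 'I_k] <->
  (forall v, v \in U <-> exists c : 'rV[K]_k, v = \sum_i c 0 i *: X i) /\
  (forall c : 'rV[K]_k, \sum_i c 0 i *: X i = 0 -> c = 0).
Proof.
pose T : k.-tuple vT := [tuple X i | i < k].
have TX (i : 'I_k) : T`_i = X i by rewrite -tnth_nth tnth_mktuple.
have spanT := span_enumP X; rewrite -[map _ _]/(T : seq vT) in spanT *.
have freeT : free T <-> forall c : 'rV[K]_k, \sum_i c 0 i *: X i = 0 -> c = 0.
  split=> [/freeP fT c c0|fT]; last first.
    apply/freeP => a a0 i.
    have := fT (\row_i a i); under eq_bigr do rewrite mxE.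
    under [X in X = 0 -> _]eq_bigr do rewrite -TX.
    by move=> /(_ a0)/rowP/(_ i); rewrite !mxE.
  apply/rowP => i; rewrite mxE; apply: (fT (fun i => c 0 i)).
  by rewrite -[RHS]c0; apply: eq_bigr => j _; rewrite TX.
rewrite /basis_of; split.
  by move=> /andP[/eqP <- /freeT fT]; split.
move=> [UE /freeT ->]; rewrite andbT; apply/eqP/vspaceP => v.
by apply/idP/idP => [/spanT/UE|/UE/spanT].
Qed.

Section OrthogonalProjection.
Context {R : rcfType}.

(** The formula for P is rational in the entries of the basis F, which will make projections smooth.
    The Gram matrix is invertible since [v *m F *m F^T = 0] forces [v *m F] to have norm zero. *)
Lemma orthogonal_projection k n (F : 'M[R]_(k, n)) : row_free F ->
  let P := F^T *m invmx (F *m F^T) *m F in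
  [/\ F *m F^T \in unitmx, P^T = P, P *m P = P &
      forall v : 'rV_n, (v <= F)%MS <-> v *m P = v].
Proof.
move=> freeF P.
have uG : F *m F^T \in unitmx.
  rewrite -row_free_unit; apply: inj_row_free => v vG.
  have : v *m F = 0.
    by apply: dot_eq0; rewrite /dot trmx_mul mulmxA -(mulmxA v) vG mul0mx mxE.
  by move=> vF; apply: (row_free_inj freeF); rewrite vF mul0mx.
have FP : F *m P = F by rewrite /P !mulmxA mulmxV// mul1mx.
split=> //.
- by rewrite /P !trmx_mul trmxK trmx_inv trmx_mul trmxK mulmxA.
- by rewrite {1}/P -!mulmxA FP mulmxA.
- move=> v; split=> [/submxP[D ->]|<-]; first by rewrite -mulmxA FP.
  by rewrite /P !mulmxA submxMl.
Qed.

(** Equal images give P Q = P and Q P = Q; transposing one of them concludes. This identifies the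
    projections computed from different bases. *)
Lemma orthogonal_projection_unique n (P Q : 'M[R]_n) :
  P^T = P -> Q^T = Q -> P *m P = P -> Q *m Q = Q ->
  (forall v : 'rV_n, v *m P = v <-> v *m Q = v) -> P = Q.
Proof.
move=> Ps Qs PP QQ PQ.
have e1 : P *m Q = P.
  by apply/row_matrixP => i; rewrite row_mul; apply/PQ; rewrite -row_mul PP.
have e2 : Q *m P = Q.
  by apply/row_matrixP => i; rewrite row_mul; apply/PQ; rewrite -row_mul QQ.
by apply: trmx_inj; rewrite -[in RHS]e2 trmx_mul Ps Qs e1.
Qed.

End OrthogonalProjection.

(** * Smooth matrix-valued functions *)

Section SmoothMatrix.
Context {R : realType} {n : nat} {M : topologicalType} (A : manifold R n M).
Context (U : set M) (oU : open U).

Definition smooth_mx_on k l (F : M -> 'M[R]_(k, l)) :=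
  forall i j, smooth_map_on A U (fun p => F p i j).

Lemma smooth_mapM (f h : M -> R) : smooth_map_on A U f -> smooth_map_on A U h ->
  smooth_map_on A U (fun p => f p * h p).
Proof. by move=> sf sh; have s := smooth_map_scale oU sf sh; exact: s. Qed.

Lemma smooth_map_prod (I : Type) (r : seq I) (P : pred I) (f : I -> M -> R) :
  (forall i, P i -> smooth_map_on A U (f i)) ->
  smooth_map_on A U (fun p => \prod_(i <- r | P i) f i p).
Proof.
move=> sf; elim: r => [|i r IH].
  have -> : (fun p => \prod_(i <- [::] | P i) f i p) = (fun=> 1).
    by apply/funext => p; rewrite big_nil.
  exact: (smooth_map_cst A U (1 : R)).
case Pi : (P i); last first.
  have -> : (fun p => \prod_(k <- i :: r | P k) f k p) =
      (fun p => \prod_(k <- r | P k) f k p) => //.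
  by apply/funext => p; rewrite big_cons Pi.
have -> : (fun p => \prod_(k <- i :: r | P k) f k p) =
    (fun p => f i p * \prod_(k <- r | P k) f k p).
  by apply/funext => p; rewrite big_cons Pi.
exact: (smooth_mapM (sf _ Pi) IH).
Qed.

Lemma smooth_mx_mul k l m (F : M -> 'M[R]_(k, l)) (H : M -> 'M[R]_(l, m)) :
  smooth_mx_on F -> smooth_mx_on H -> smooth_mx_on (fun p => F p *m H p).
Proof.
move=> sF sH i j.
have -> : (fun p => (F p *m H p) i j) = (fun p => \sum_k F p i k * H p k j).
  by apply/funext => p; rewrite mxE.
by apply: (smooth_map_sum oU) => k' _; exact: smooth_mapM.
Qed.

Lemma smooth_mx_tr k l (F : M -> 'M[R]_(k, l)) : smooth_mx_on F ->
  smooth_mx_on (fun p => (F p)^T).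
Proof.
move=> sF i j; have -> : (fun p => (F p)^T i j) = (fun p => F p j i).
  by apply/funext => p; rewrite mxE.
exact: sF.
Qed.

Lemma smooth_map_det k (F : M -> 'M[R]_k) : smooth_mx_on F ->
  smooth_map_on A U (fun p => \det (F p)).
Proof.
move=> sF; apply: (smooth_map_sum oU) => s _; apply: smooth_mapM.
  exact: smooth_map_cst.
by apply: smooth_map_prod => i _; exact: sF.
Qed.

(** Cramer's rule: cofactors and determinant are polynomial in the entries. *)
Lemma smooth_mx_inv k (F : M -> 'M[R]_k) : smooth_mx_on F ->
  (forall p, U p -> F p \in unitmx) -> smooth_mx_on (fun p => invmx (F p)).
Proof.
move=> sF uF i j.
have sdet := smooth_map_det sF.
have det0 p : U p -> \det (F p) != 0.
  by move=> /uF; rewrite unitmxE unitfE.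
have scof : smooth_map_on A U (fun p => cofactor (F p) j i).
  apply: smooth_mapM; first exact: smooth_map_cst.
  apply: smooth_map_det => a b.
  have -> : (fun p => row' j (col' i (F p)) a b) =
      (fun p => F p (lift j a) (lift i b)) by apply/funext => p; rewrite !mxE.
  exact: sF.
apply: (eq_smooth_map oU _ (smooth_mapM (smooth_map_inv oU det0 sdet) scof)).
by move=> p /uF uFp; rewrite /invmx uFp !mxE.
Qed.

End SmoothMatrix.

(** * Orthonormal frames with constant structure *)

Lemma linear_pack (K : pzRingType) (U V : lmodType K) (f : U -> V) : linear f ->
  exists l : {linear U -> V}, forall x, f x = l x.
Proof.
move=> lf; pose fM := GRing.isLinear.Build _ _ _ _ _ lf.
by pose l : {linear U -> V} := HB.pack f fM; exists l.
Qed.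

Section FrameCalculus.
Context {R : realType} {n : nat} {M : topologicalType} (A : manifold R n M).
Context (g : riemannian_metric A) (Gam : {linear 'rV[R]_n -> 'M[R]_n}).
Context (fr : 'rV[R]_n -> vfield R n M).
Implicit Types (X Y Z : vfield R n M) (u v w : 'rV[R]_n) (c d : M -> 'rV[R]_n).

Hypothesis Gam_skew : forall x, (Gam x)^T = - Gam x.
Hypothesis fr_linear : forall p, linear (fun u => fr u p).
Hypothesis fr_metric : forall p u v, g p (fr u p) (fr v p) = dot u v.
Hypothesis fr_smooth : forall u, smooth_vfield A (fr u).
Hypothesis fr_bracket : forall u v, bracket A (fr u) (fr v) = fr (lie Gam u v).

(* Coordinates in the frame [fr] of a tangent vector at p. *)
Definition co p u : 'rV[R]_n := \row_j g p u (fr (delta_mx 0 j) p).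

Lemma metric0 p u : g p 0 u = 0.
Proof.
have := riemannian_linear g p 1 0 0 u.
by rewrite scaler0 addr0 mul1r => /eqP; rewrite -subr_eq0 opprD addNKr oppr_eq0
  => /eqP.
Qed.

Lemma co_linear p : linear (co p).
Proof.
by move=> a u v; apply/rowP => j; rewrite !mxE riemannian_linear.
Qed.

Lemma coD p u v : co p (u + v) = co p u + co p v.
Proof. by have := co_linear p 1 u v; rewrite !scale1r. Qed.

Lemma coZ p a u : co p (a *: u) = a *: co p u.
Proof. by have [l lE] := linear_pack (co_linear p); rewrite !lE linearZ. Qed.

Lemma coK p u : co p (fr u p) = u.
Proof. by apply/rowP => j; rewrite mxE fr_metric dot_delta. Qed.

Lemma fr_sum p u : fr u p = \sum_j u 0 j *: fr (delta_mx 0 j) p.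
Proof.
have [l lE] := linear_pack (fr_linear p).
rewrite lE {1}(row_sum_delta u) linear_sum.
by apply: eq_bigr => j _; rewrite linearZ lE.
Qed.

Lemma frD p u v : fr (u + v) p = fr u p + fr v p.
Proof. by have := fr_linear p 1 u v; rewrite !scale1r. Qed.

Lemma frZ p a u : fr (a *: u) p = a *: fr u p.
Proof. by have [l lE] := linear_pack (fr_linear p); rewrite !lE linearZ. Qed.

Lemma fr0 p : fr 0 p = 0.
Proof. by have [l lE] := linear_pack (fr_linear p); rewrite lE linear0. Qed.

Lemma frB p u v : fr (u - v) p = fr u p - fr v p.
Proof. by rewrite frD -scaleN1r frZ scaleN1r. Qed.

Lemma frK p u : fr (co p u) p = u.
Proof.
pose F : 'M[R]_n := \matrix_(i < n) (fr (delta_mx 0 i) p).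
have FE w : w *m F = fr w p.
  rewrite mulmx_sum_row fr_sum; apply: eq_bigr => i _; by rewrite rowK.
have Funit : F \in unitmx.
  rewrite -row_free_unit; apply: inj_row_free => w; rewrite FE => w0.
  by apply: dot_eq0; rewrite -(fr_metric p) w0 metric0.
have -> : u = fr (u *m invmx F) p by rewrite -FE mulmxKV.
by rewrite coK.
Qed.

Lemma metric_co p u v : g p u v = dot (co p u) (co p v).
Proof. by rewrite -(fr_metric p) !frK. Qed.

Lemma smooth_co U X : open U -> smooth_vfield_on A U X ->
  smooth_map_on A U (fun p => co p (X p)).
Proof.
move=> oU sX; apply: (smooth_map_rV oU) => j.
have sf := smooth_vfieldS U (fr_smooth (delta_mx 0 j)).
have -> : (fun p => co p (X p) 0 j) = (fun p => g p (X p) (fr (delta_mx 0 j)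
  p)).
  by apply/funext => p; rewrite mxE.
exact: (riemannian_smooth g oU sX sf).
Qed.

Lemma act_fr (W : normedModType R) Y (f : M -> W) p u : mdifferentiable A f p ->
  Y p = fr u p -> act A Y f p = \sum_j u 0 j *: act A (fr (delta_mx 0 j)) f p.
Proof.
move=> df Yp; have actE X : act A X f p = _ := act_lin X df.
rewrite actE Yp fr_sum linear_sum; apply: eq_bigr => j _.
by rewrite linearZ actE.
Qed.

Lemma smooth_fr U c : open U -> smooth_map_on A U c ->
  smooth_vfield_on A U (fun p => fr (c p) p).
Proof.
move=> oU sc q k; pose f := chart_map (chart_at A q).
set D := chart_dom (chart_at A q); have oD : open D := chart_dom_open _.
have oUD : open (U `&` D) by exact: openI.
have sf : smooth_map_on A D f := smooth_map_chart A q.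
pose h p := \sum_j c p 0 j *: act A (fr (delta_mx 0 j)) f p.
have sh : smooth_map_on A (U `&` D) h.
  apply: (smooth_map_sum oUD) => j _; apply: (smooth_map_scale oUD).
    have s1 := smooth_map_coord 0 j oUD (smooth_map_sub (@subIsetl _ U D) sc).
    exact: s1.
  apply: (smooth_map_sub (@subIsetr _ _ _)).
  exact: (smooth_map_act oD (smooth_vfieldS _ (fr_smooth _)) sf).
apply: (eq_times_differentiable _ _ (times_differentiable_sub _ (sh q k))).
- exact: (chart_image_open oU).
- move=> y yU; have [qy Uy _] := chart_imageP yU.
  exact: (esym (act_fr (smooth_mdifferentiable sf qy) erefl)).
- by move=> _ [p [Dp Up] <-]; exists p.
Qed.

Lemma act_act_fr X Y p : smooth_vfield A X -> smooth_vfield A Y ->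
  act A X (act A Y (chart_map (chart_at A p))) p =
  fr (act A X (fun q => co q (Y q)) p) p +
  act A (fr (co p (X p))) (act A (fr (co p (Y p))) (chart_map (chart_at A p)))
    p.
Proof.
move=> sX sY; pose f := chart_map (chart_at A p); rewrite -/f.
pose U := chart_dom (chart_at A p).
have oU : open U := chart_dom_open _.
have Up : U p := mem_chart_at A p.
have sf : smooth_map_on A U f := smooth_map_chart A p.
pose e j := fr (delta_mx 0 j).
have sH j : smooth_map_on A U (act A (e j) f).
  exact: (smooth_map_act oU (smooth_vfieldS _ (fr_smooth _)) sf).
have dH j := smooth_mdifferentiable (sH j) Up.
have sc := smooth_co oU (smooth_vfieldS U sY).
have dc := smooth_mdifferentiable sc Up.
have dcj j := smooth_mdifferentiable (smooth_map_coord 0 j oU sc) Up.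
have nE : \forall q \near p, act A Y f q = \sum_j co q (Y q) 0 j *: act A (e j)
  f q.
  near=> q; have Uq : U q by near: q; exact: (open_near oU Up).
  exact: (act_fr (smooth_mdifferentiable sf Uq) (esym (frK _ _))).
have nE0 : \forall q \near p,
    act A (fr (co p (Y p))) f q = \sum_j co p (Y p) 0 j *: act A (e j) f q.
  near=> q; have Uq : U q by near: q; exact: (open_near oU Up).
  exact: (act_fr (smooth_mdifferentiable sf Uq) erefl).
have dk j := mdifferentiable_cst A (co p (Y p) 0 j) p.
apply: etrans (near_eq_act A X nE) _.
apply: etrans (act_sum X (index_enum _) (fun j => mdifferentiable_scale (dcj j)
  (dH j))) _.
apply: etrans (eq_bigr _ (fun j _ => act_scale X (dcj j) (dH j))) _.
apply: etrans (big_split _ _ _ _ _) _; congr (_ + _).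
  apply: etrans (eq_bigr _ (fun j _ => congr1 (fun a => a *: _)
    (esym (act_coord X j dc)))) _.
  apply: etrans (esym (act_fr (Y := fr (act A X (fun q => co q (Y q)) p))
    (smooth_mdifferentiable sf Up) erefl)) _.
  exact: act_chart.
apply: etrans (eq_bigr _ (fun j _ => esym (act_scaler X _ (dH j)))) _.
apply: etrans (esym (act_sum X (index_enum _)
  (fun j => mdifferentiable_scale (dk j) (dH j)))) _.
apply: etrans (esym (near_eq_act A X nE0)) _.
by apply: eq_act; rewrite frK.
Unshelve. all: by end_near. Qed.

Lemma bracket_co X Y p : smooth_vfield A X -> smooth_vfield A Y ->
  bracket A X Y p = fr (act A X (fun q => co q (Y q)) p -
    act A Y (fun q => co q (X q)) p + lie Gam (co p (X p)) (co p (Y p))) p.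
Proof.
move=> sX sY; apply: etrans (bracket_chart A X Y p) _.
apply: etrans (congr2 (fun a b => a - b) (act_act_fr p sX sY) (act_act_fr p sY
  sX)) _.
have fin (a b c d e : 'rV[R]_n) : c - d = e -> (a + c) - (b + d) = (a - b) + e.
  by move=> <-; rewrite opprD addrACA.
rewrite frD frB; apply: fin.
apply: etrans (esym (bracket_chart A _ _ p)) _.
exact: (congr1 (fun V : vfield R n M => V p) (fr_bracket _ _)).
Qed.

(** The connection whose Christoffel symbols in the frame are the constants given by [Gam]. *)
Definition nabla0 X Y : vfield R n M := fun p =>
  fr (act A X (fun q => co q (Y q)) p + co p (Y p) *m Gam (co p (X p))) p.

Lemma smooth_gam U c d : open U -> smooth_map_on A U c -> smooth_map_on A U d ->
  smooth_map_on A U (fun p => c p *m Gam (d p)).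
Proof.
move=> oU sc sd.
have -> : (fun p => c p *m Gam (d p)) =
    fun p => \sum_j d p 0 j *: \sum_i c p 0 i *: row i (Gam (delta_mx 0 j)).
  apply/funext => p; rewrite {1}(row_sum_delta (d p)) linear_sum mulmx_sumr.
  by apply: eq_bigr => j _; rewrite linearZ/= -scalemxAr mulmx_sum_row.
apply: (smooth_map_sum oU) => j _; apply: (smooth_map_scale oU).
  exact: (smooth_map_coord 0 j oU sd).
apply: (smooth_map_sum oU) => i _; apply: (smooth_map_scale oU).
  exact: (smooth_map_coord 0 i oU sc).
exact: smooth_map_cst.
Qed.

Lemma smooth_coT X : smooth_vfield A X -> smooth_map_on A setT (fun p => co p (X
  p)).
Proof. exact: smooth_co openT. Qed.

Lemma mdifferentiable_co X p : smooth_vfield A X ->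
  mdifferentiable A (fun p => co p (X p)) p.
Proof. by move=> sX; exact: (smooth_mdifferentiable (smooth_coT sX) I). Qed.

Lemma smooth_nabla0 X Y : smooth_vfield A X -> smooth_vfield A Y ->
  smooth_vfield A (nabla0 X Y).
Proof.
move=> sX sY; apply: (smooth_fr openT); apply: (smooth_mapD openT).
  exact: (smooth_map_act openT sX (smooth_coT sY)).
exact: (smooth_gam openT (smooth_coT sY) (smooth_coT sX)).
Qed.

Lemma nabla0_connection : is_connection A nabla0.
Proof.
split.
- exact: smooth_nabla0.
- move=> X X' Y sX sX' sY; apply/funext => p.
  have XE : (X + X') p = 1 *: X p + X' p by rewrite scale1r.
  have e := act_linear (mdifferentiable_co p sY) XE.
  apply: etrans (congr1 (fun a => fr (a + co p (Y p) *m Gam (co p ((X + X') p)))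
    p) e) _.
  rewrite scale1r; apply: etrans _ (frD _ _ _); congr (fr _ p).
  by rewrite coD linearD mulmxDr addrACA.
- move=> f X Y sf sX sY; apply/funext => p.
  have e := act_linear (Y := fun=> 0) (mdifferentiable_co p sY)
    (esym (addr0 (f p *: X p)) : (fun q => f q *: X q) p = f p *: X p + (fun=>
      0) p).
  have e0 := act_lin (fun=> 0) (mdifferentiable_co p sY).
  apply: etrans (congr1 (fun a => fr (a + co p (Y p) *m Gam (co p (f p *: X p)))
    p) e) _.
  apply: etrans _ (frZ _ _ _); congr (fr _ p).
  by rewrite e0 linear0 addr0 coZ linearZ/= -scalemxAr scalerDr.
- move=> X Y Y' sX sY sY'; apply/funext => p.
  have cE : (fun q => co q ((Y + Y') q)) = (fun q => co q (Y q) + co q (Y' q)).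
    by apply/funext => q; rewrite coD.
  have e := actD X (mdifferentiable_co p sY) (mdifferentiable_co p sY').
  apply: etrans (congr1 (fun a => fr (a + co p ((Y + Y') p) *m Gam (co p (X p)))
    p)
    (etrans (congr1 (fun c => act A X c p) cE) e)) _.
  apply: etrans _ (frD _ _ _); congr (fr _ p).
  by rewrite coD mulmxDl addrACA.
- move=> f X Y sf sX sY; apply/funext => p.
  have cE : (fun q => co q (f q *: Y q)) = (fun q => f q *: co q (Y q)).
    by apply/funext => q; rewrite coZ.
  have df : mdifferentiable A f p by exact: (smooth_mdifferentiable (U := setT)
    sf I).
  have e := act_scale X df (mdifferentiable_co p sY).
  apply: etrans (congr1 (fun a => fr (a + co p (f p *: Y p) *m Gam (co p (X p)))
    p)
    (etrans (congr1 (fun c => act A X c p) cE) e)) _.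
  rewrite -[in RHS](frK p (Y p)) -!frZ -frD; congr (fr _ p).
  by rewrite coZ -scalemxAl scalerDr addrA.
Qed.

Lemma act_dot X c d p : mdifferentiable A c p -> mdifferentiable A d p ->
  act A X (fun q => dot (c q) (d q)) p =
  dot (act A X c p) (d p) + dot (c p) (act A X d p).
Proof.
move=> dc dd.
have dcj j : mdifferentiable A (fun q => c q 0 j) p.
  exact: (differentiable_comp dc (differentiable_coord _ _ _)).
have ddj j : mdifferentiable A (fun q => d q 0 j) p.
  exact: (differentiable_comp dd (differentiable_coord _ _ _)).
have -> : (fun q => dot (c q) (d q)) = (fun q => \sum_j c q 0 j *: d q 0 j).
  by apply/funext => q; rewrite dotE.
apply: etrans (act_sum X (index_enum _) (fun j => mdifferentiable_scale (dcj j)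
  (ddj j))) _.
apply: etrans (eq_bigr _ (fun j _ => act_scale X (dcj j) (ddj j))) _.
apply: etrans (big_split _ _ _ _ _) _; rewrite !dotE; congr (_ + _).
  apply: eq_bigr => j _; exact: (congr1 (fun a => a * _) (esym (act_coord X j
    dc))).
apply: eq_bigr => j _; exact: (congr1 (fun a => _ * a) (esym (act_coord X j
  dd))).
Qed.

Lemma nabla0_levi_civita : is_levi_civita g nabla0.
Proof.
split; first exact: nabla0_connection.
- move=> X Y Z sX sY sZ p.
  have cE : (fun q => g q (Y q) (Z q)) = (fun q => dot (co q (Y q)) (co q (Z
    q))).
    by apply/funext => q; exact: metric_co.
  apply: etrans (congr1 (fun f => act A X f p) cE) _.
  apply: etrans (act_dot X (mdifferentiable_co p sY) (mdifferentiable_co p sZ))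
    _.
  rewrite !metric_co !coK dotDl dotDr dot_skew//.
  by rewrite addrACA addNr addr0.
- move=> X Y sX sY; apply/funext => p; apply: etrans _ (esym (bracket_co p sX
  sY)).
  apply: etrans (esym (frB p _ _)) _; congr (fr _ p).
  by rewrite /lie opprD addrACA.
Qed.

(** * Uniqueness of the Levi-Civita connection *)

Lemma koszul nabla X Y Z p : is_levi_civita g nabla ->
  smooth_vfield A X -> smooth_vfield A Y -> smooth_vfield A Z ->
  2 * g p (nabla X Y p) (Z p) =
    act A X (fun q => g q (Y q) (Z q)) p + act A Y (fun q => g q (Z q) (X q)) p
      -
    act A Z (fun q => g q (X q) (Y q)) p +
    g p (bracket A X Y p) (Z p) - g p (bracket A Y Z p) (X p) +
    g p (bracket A Z X p) (Y p).
Proof.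
move=> [_ compat torsion] sX sY sZ.
have tE V W : smooth_vfield A V -> smooth_vfield A W ->
    forall u, g p (bracket A V W p) u = g p (nabla V W p) u - g p (nabla W V p)
      u.
  move=> sV sW u; have e : bracket A V W p = nabla V W p - nabla W V p.
    exact: (congr1 (fun F : vfield R n M => F p) (esym (torsion _ _ sV sW))).
  rewrite e !metric_co coD -scaleN1r coZ dotDl dotZl.
  by rewrite mulN1r.
have fin (a b c d e f c1 c2 c3 t1 t2 t3 : R) : c1 = a + b -> c2 = c + d ->
    c3 = e + f -> t1 = a - d -> t2 = c - f -> t3 = e - b ->
    2 * a = c1 + c2 - c3 + t1 - t2 + t3.
  by move=> -> -> -> -> -> ->; ring.
have s V U W : g p (V p) (nabla U W p) = g p (nabla U W p) (V p).
  exact: riemannian_sym.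
exact: (fin _ _ _ _ _ _ _ _ _ _ _ _
  (etrans (compat _ _ _ sX sY sZ p) (congr1 (fun a => _ + a) (s _ _ _)))
  (etrans (compat _ _ _ sY sZ sX p) (congr1 (fun a => _ + a) (s _ _ _)))
  (etrans (compat _ _ _ sZ sX sY p) (congr1 (fun a => _ + a) (s _ _ _)))
  (tE _ _ sX sY _) (tE _ _ sY sZ _) (tE _ _ sZ sX _)).
Qed.

(** Koszul's formula, tested against the frame fields, determines the connection. The unspecified
    connection of [reducible_holonomy] may therefore be computed as [nabla0]. *)
Lemma levi_civita_unique nabla X Y : is_levi_civita g nabla ->
  smooth_vfield A X -> smooth_vfield A Y -> nabla X Y = nabla0 X Y.
Proof.
move=> LC sX sY; apply/funext => p; rewrite -[LHS](frK p) -[RHS](frK p).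
congr (fr _ p); apply: dot_inj => w.
rewrite -{1 2}(coK p w) -!metric_co.
have e1 := koszul p LC sX sY (fr_smooth w).
have e2 := koszul p nabla0_levi_civita sX sY (fr_smooth w).
have two : (2 : R) != 0 by rewrite pnatr_eq0.
exact: (mulfI two (etrans e1 (esym e2))).
Qed.

Lemma act_mulmxr m X c p (B : 'M[R]_(n, m)) : mdifferentiable A c p ->
  act A X (fun q => c q *m B) p = act A X c p *m B.
Proof.
move=> dc; have dcj j : mdifferentiable A (fun q => c q 0 j) p.
  exact: (differentiable_comp dc (differentiable_coord _ _ _)).
have -> : (fun q => c q *m B) = fun q => \sum_j c q 0 j *: row j B.
  by apply/funext => q; rewrite mulmx_sum_row.
have dB j := mdifferentiable_cst A (row j B) p.
apply: etrans (act_sum X (index_enum _) (fun j => mdifferentiable_scale (dcj j)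
  (dB j))) _.
apply: etrans _ (esym (mulmx_sum_row _ _)); apply: eq_bigr => j _.
apply: etrans (act_scale X (dcj j) (dB j)) _.
by rewrite act_cst scaler0 addr0 -(act_coord X j dc).
Qed.

(** * Stability of a parallel distribution under the holonomy generators *)

Section Parallel.
Context (nabla : vfield R n M -> vfield R n M -> vfield R n M).
Context (k : nat) (D : M -> {vspace 'rV[R]_n}).
Hypothesis LC : is_levi_civita g nabla.
Hypothesis distD : is_distribution A k D.
Hypothesis parD : parallel A nabla D.

Lemma local_frame p : exists (U : set M) (F : M -> 'M[R]_(k, n)),
  [/\ open U, U p, smooth_mx_on A U F &
      forall q, U q -> row_free (F q) /\
        forall v, fr v q \in D q <-> (v <= F q)%MS].
Proof.
have [U [E [oU Up sE bE]]] := distD p.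
pose F q : 'M[R]_(k, n) := \matrix_(i < k) co q (E i q).
exists U, F; split=> // [i j|q Uq].
  have -> : (fun p => F p i j) = (fun p => co p (E i p) 0 j).
    by apply/funext => q; rewrite mxE.
  exact: (smooth_map_coord 0 j oU (smooth_co oU (sE i))).
have /basis_of_enumP[spanE freeE] := bE q Uq.
have FE (a : 'rV_k) : a *m F q = co q (\sum_i a 0 i *: E i q).
  have [l lE] := linear_pack (co_linear q).
  rewrite mulmx_sum_row lE linear_sum; apply: eq_bigr => i _.
  by rewrite rowK linearZ lE.
split.
  apply: inj_row_free => a; rewrite FE => a0; apply: freeE.
  by rewrite -[LHS](frK q) a0 fr0.
move=> v; split=> [/spanE[a aE]|/submxP[a aE]].
  by apply/submxP; exists a; rewrite FE -aE coK.
by apply/spanE; exists a; rewrite aE FE frK.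
Qed.

(** The orthogonal projections onto D are chosen point by point; being unique, they agree near each
    point with the formula in a local frame, hence are smooth. *)
Lemma projection_field : exists P : M -> 'M[R]_n,
  [/\ smooth_mx_on A setT P,
      forall p, (P p)^T = P p, forall p, P p *m P p = P p,
      forall p, \rank (P p) = k &
      forall p v, fr v p \in D p <-> v *m P p = v].
Proof.
have /choice[P PE] : forall p, exists Q : 'M[R]_n,
    [/\ Q^T = Q, Q *m Q = Q, \rank Q = k & forall v,
      fr v p \in D p <-> v *m Q = v].
  move=> p; have [U [F [_ Up _ /(_ p Up)[freeF FD]]]] := local_frame p.
  have [uF Qs QQ QF] := orthogonal_projection freeF.
  set Q := _ *m F p in Qs QQ QF; exists Q; split=> //; last first.
    by move=> v; apply: iff_trans (FD v) _; exact: QF.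
  have QleF : (Q <= F p)%MS by rewrite submxMl.
  have FleQ : (F p <= Q)%MS.
    apply/row_subP => i; have /QF <- := row_sub i (F p); exact: submxMl.
  by move/eqP: freeF => <-; apply/eqP; rewrite eqn_leq !mxrankS.
exists P; split=> [i j|p|p|p|p].
- apply: smooth_map_local => p _.
  have [U [F [oU Up sF FD]]] := local_frame p.
  exists U; split=> //.
  have sT := smooth_mx_tr sF; have sG := smooth_mx_mul oU sF sT.
  have uG q : U q -> F q *m (F q)^T \in unitmx.
    by move=> /FD[fq _]; have [] := orthogonal_projection fq.
  have sQ := smooth_mx_mul oU (smooth_mx_mul oU sT (smooth_mx_inv oU sG uG)) sF.
  apply: (eq_smooth_map oU _ (sQ i j)) => q Uq.
  have [fq qD] := FD q Uq; have [_ Qs QQ QF] := orthogonal_projection fq.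
  have [Ps PP _ PD] := PE q.
  congr (fun_of_matrix _ i j); apply: orthogonal_projection_unique => // v.
  apply: iff_trans (iff_sym (QF v)) _; apply: iff_trans (iff_sym (qD v)) _.
  exact: PD.
- by have [] := PE p.
- by have [] := PE p.
- by have [] := PE p.
- by have [] := PE p.
Qed.

Definition section_coords c :=
  smooth_map_on A setT c /\ forall p, fr (c p) p \in D p.

(* The projection onto D provides enough global sections; no bump function is
   needed. *)
Lemma section_coords_ex p v : fr v p \in D p ->
  exists2 c, section_coords c & c p = v.
Proof.
have [P [sP _ PP _ PD]] := projection_field => /PD vP.
exists (fun q => v *m P q) => //; split=> [|q]; last first.
  by apply/PD; rewrite -mulmxA PP.
apply: (smooth_map_rV openT) => j.
have sv : smooth_mx_on A setT (fun=> v) by move=> a b; exact: smooth_map_cst.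
exact: (smooth_mx_mul openT sv sP 0 j).
Qed.

(** Coordinates of the covariant derivative, along [fr x], of the field with coordinates c. *)
Definition cov x c p := act A (fr x) c p + c p *m Gam x.

Lemma section_coords_smooth c : smooth_map_on A setT c ->
  smooth_vfield A (fun p => fr (c p) p).
Proof. exact: smooth_fr openT. Qed.

Lemma section_coords_cov x c : section_coords c -> section_coords (cov x c).
Proof.
move=> [sc cD]; split.
  apply: (smooth_mapD openT); first exact: (smooth_map_act openT (fr_smooth x)
    sc).
  have sx : smooth_map_on A setT (fun=> x) := smooth_map_cst A setT x.
  exact: (smooth_gam openT sc sx).
move=> p; have sY := section_coords_smooth sc.
have := parD (fr_smooth x) sY cD p.
rewrite (levi_civita_unique LC (fr_smooth x) sY) /nabla0 !coK.
have -> : (fun q => co q (fr (c q) q)) = c by apply/funext => q; rewrite coK.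
by [].
Qed.

(** The curvature is a commutator of covariant derivatives, which preserve the sections of D. All
    derivatives of c cancel, leaving a term in [c p] alone. *)
Lemma section_coords_curv x y c p : section_coords c ->
  fr (c p *m curv Gam x y) p \in D p.
Proof.
move=> Sc; have [sc cD] := Sc.
have dc : mdifferentiable A c p := smooth_mdifferentiable sc I.
have da z : mdifferentiable A (act A (fr z) c) p.
  exact: (smooth_mdifferentiable (smooth_map_act openT (fr_smooth z) sc) I).
have covcov z w : cov z (cov w c) p = act A (fr z) (act A (fr w) c) p +
    act A (fr z) c p *m Gam w + (act A (fr w) c p *m Gam z + c p *m Gam w *m Gam
      z).
  have dg : mdifferentiable A (fun q => c q *m Gam w) p.
    have sw : smooth_map_on A setT (fun=> w) := smooth_map_cst A setT w.
    exact: (smooth_mdifferentiable (smooth_gam openT sc sw) I).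
  apply: etrans (congr1 (fun a => a + cov w c p *m Gam z)
    (etrans (actD (fr z) (da w) dg) (congr1 (fun a => _ + a) (act_mulmxr (fr z)
      (Gam w) dc)))) _.
  by rewrite /cov mulmxDl.
have br : act A (fr (lie Gam x y)) c p =
    act A (fr x) (act A (fr y) c) p - act A (fr y) (act A (fr x) c) p.
  apply: etrans (congr1 (fun V => act A V c p) (esym (fr_bracket x y))) _.
  exact: (bracketE openT I (fr_smooth x) (fr_smooth y) sc).
have -> : c p *m curv Gam x y =
    cov x (cov y c) p - cov y (cov x c) p - cov (lie Gam x y) c p.
  have fin (a a' b e u w l : 'rV[R]_n) : u - w - l =
      a + b + (e + u) - (a' + e + (b + w)) - (a - a' + l).
    by apply/rowP => i; rewrite !(addmxE, oppmxE); ring.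
  have e3 : cov (lie Gam x y) c p = _ - _ + _ := congr1 (fun a => a + _) br.
  apply: etrans _ (esym (congr2 (fun u v => u - v)
    (congr2 (fun u v => u - v) (covcov x y) (covcov y x)) e3)).
  by rewrite /curv !mulmxBr !mulmxA; exact: fin.
rewrite !frB !rpredB//.
- by have [_] := section_coords_cov x (section_coords_cov y Sc); apply.
- by have [_] := section_coords_cov y (section_coords_cov x Sc); apply.
- by have [_] := section_coords_cov (lie Gam x y) Sc; apply.
Qed.

(** A vector of D extends to a section c, and [c *m h] is again a section by induction. By the
    product rule, the bracket is the difference between differentiating c before and after applying
    h. *)
Lemma hol_section h : hol Gam h -> forall p v, fr v p \in D p -> fr (v *m h) p
  \in D p.
Proof.
elim=> {h} [x y|x h _ IH] p v /section_coords_ex[c Sc <-].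
  exact: section_coords_curv.
have [sc cD] := Sc; have dc : mdifferentiable A c p := smooth_mdifferentiable sc
  I.
have Sh : section_coords (fun q => c q *m h).
  split=> [|q]; last exact: IH.
  apply: (smooth_map_rV openT) => j.
  have sh : smooth_mx_on A setT (fun=> h) by move=> a b; exact: smooth_map_cst.
  have s1 : smooth_mx_on A setT c by move=> a b; exact: (smooth_map_coord a b
    openT sc).
  exact: (smooth_mx_mul openT s1 sh 0 j).
have -> : c p *m (Gam x *m h - h *m Gam x) =
    cov x c p *m h - cov x (fun q => c q *m h) p.
  have e : cov x (fun q => c q *m h) p = act A (fr x) c p *m h + c p *m h *m Gam
    x.
    exact: (congr1 (fun a => a + _) (act_mulmxr (fr x) h dc)).
  by rewrite e /cov mulmxDl mulmxBr !mulmxA [in RHS]opprD addrACA subrr add0r.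
rewrite frB rpredB//; first by apply: IH; have [_] := section_coords_cov x Sc;
  apply.
by have [_] := section_coords_cov x Sh; apply.
Qed.

Lemma parallel_invariant_subspace (p0 : M) : (0 < k < n)%N ->
  (forall x y z, lie Gam x (lie Gam y z) + lie Gam y (lie Gam z x) +
    lie Gam z (lie Gam x y) = 0) ->
  exists W : 'M[R]_n, (0 < \rank W < n)%N /\ forall x, (W *m Gam x <= W)%MS.
Proof.
move=> kn jac; have [P [_ Ps PP rP PD]] := projection_field.
apply: (invariant_subspace Gam_skew jac (Ps p0) (PP p0)); first by rewrite rP.
move=> h hh.
(* Stability of D under h reads P h P = P h; as h is skew and P symmetric, transposing gives P h P =
   h P. *)
have PhP : P p0 *m h *m P p0 = P p0 *m h.
  apply/row_matrixP => i; rewrite !row_mul; apply/PD; apply: hol_section => //.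
  by apply/PD; rewrite -row_mul PP.
have hs := hol_skew Gam_skew hh.
have := congr1 trmx PhP; rewrite !trmx_mul Ps hs !(mulmxN,
  mulNmx) mulmxA => /oppr_inj.
by rewrite PhP => ->.
Qed.

End Parallel.

Lemma invariant_subspace_parallel (W : 'M[R]_n) : (0 < \rank W < n)%N ->
  (forall x, (W *m Gam x <= W)%MS) -> reducible_holonomy g.
Proof.
move=> rW WG.
pose E (i : 'I_(\rank W)) := fr (row i (row_base W)).
pose D q := <<[seq E i q | i <- enum 'I_(\rank W)]>>%VS.
have EE q (a : 'rV_(\rank W)) : \sum_i a 0 i *: E i q = fr (a *m row_base W) q.
  have [l lE] := linear_pack (fr_linear q).
  rewrite lE mulmx_sum_row linear_sum; apply: eq_bigr => i _.
  by rewrite linearZ/= -lE.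
have freeE q (a : 'rV_(\rank W)) : \sum_i a 0 i *: E i q = 0 -> a = 0.
  rewrite EE => a0; apply: (row_free_inj (row_base_free W)).
  by rewrite mul0mx; apply: dot_eq0; rewrite -(fr_metric q) a0 metric0.
have bD q : basis_of (D q) [seq E i q | i <- enum 'I_(\rank W)].
  by apply/basis_of_enumP; split; [exact: span_enumP|exact: freeE].
have DE q v : fr v q \in D q <-> (v <= W)%MS.
  have /basis_of_enumP[spanE _] := bD q.
  rewrite -(eq_row_base W); split=> [/spanE[a]|/submxP[a ->]].
    by rewrite EE => e; rewrite -(coK q v) e coK submxMl.
  by apply/spanE; exists a; rewrite EE.
exists nabla0, (\rank W), D.
split; [exact: nabla0_levi_civita| |exact: rW|].
  move=> p; exists setT, E.
  split; [exact: openT|exact: I| |by move=> q _; exact: bD].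
  by move=> i; exact: (smooth_vfieldS setT (fr_smooth _)).
move=> X Y sX sY YD p; apply/DE.
have cW q : (co q (Y q) <= W)%MS by apply/(DE q); rewrite frK; exact: YD.
apply: addmx_sub; last exact: submx_trans (submxMr _ (cW p)) (WG _).
have dc := mdifferentiable_co p sY.
(* Membership in W is a linear equation with the constant matrix [cokermx W], so the derivative of
   the coordinates of Y satisfies it too. *)
rewrite submxE; apply/eqP; apply: etrans (esym (act_mulmxr X (cokermx W) dc)) _.
have -> : (fun q => co q (Y q) *m cokermx W) = fun=> 0.
  by apply/funext => q; apply/eqP; rewrite -submxE.
exact: act_cst.
Qed.

End FrameCalculus.

(** * The theorem *)

Section InvariantFrame.
Context {R : realType} {n : nat} {G : groupTopologicalType} (L : lie_group R n
  G).
Context (g : riemannian_metric L).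
Hypothesis g_left_invariant : left_invariant_metric g.

Definition gram : 'M[R]_n :=
  \matrix_(i < n, j < n) g 1%g (delta_mx 0 i) (delta_mx 0 j).

Lemma gramE u v : (u *m gram *m v^T) 0 0 = g 1%g u v.
Proof.
have glin w : linear (fun u => g 1%g u w : R^o).
  by move=> a x y; exact: riemannian_linear.
have gE x y : g 1%g x y = \sum_i x 0 i * g 1%g (delta_mx 0 i) y.
  have [l lE] := linear_pack (glin y).
  rewrite -[LHS]/(g 1%g x y : R^o) lE {1}(row_sum_delta x) linear_sum.
  by apply: eq_bigr => i _; rewrite linearZ/= -lE.
rewrite gE -mulmxA mxE; apply: eq_bigr => i _; congr (_ * _).
rewrite riemannian_sym gE mxE; apply: eq_bigr => j _.
by rewrite !mxE mulrC riemannian_sym.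
Qed.

Lemma orthonormal_basis : exists T : 'M[R]_n, T *m gram *m T^T = 1%:M.
Proof.
apply: gram_schmidt => [|v v0]; last by rewrite gramE riemannian_pos.
by apply/matrixP => i j; rewrite !mxE riemannian_sym.
Qed.

Lemma lifield_metric a u v : g a (lifield L u a) (lifield L v a) = g 1%g u v.
Proof.
have e : left_translation a 1%g = a by rewrite /left_translation mulg1.
by have := g_left_invariant a 1%g u v; rewrite e.
Qed.

(** The rows of T are an orthonormal basis at the unit; their left-invariant extensions stay
    orthonormal because the metric is left-invariant. The bracket in this frame has constant
    coefficients [br], from which [koszul_connection] builds [Gam]. *)
Lemma invariant_frame : exists (Gam : {linear 'rV[R]_n -> 'M[R]_n})
    (fr : 'rV[R]_n -> vfield R n G),
  [/\ forall x, (Gam x)^T = - Gam x,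
      forall x y z, lie Gam x (lie Gam y z) + lie Gam y (lie Gam z x) +
        lie Gam z (lie Gam x y) = 0,
      forall u v, bracket L (fr u) (fr v) = fr (lie Gam u v),
      (forall p, linear (fun u => fr u p)) /\
      (forall p u v, g p (fr u p) (fr v p) = dot u v) &
      (forall u, lie_algebra L (fr u)) /\
      (forall X, lie_algebra L X -> exists u, X = fr u)].
Proof.
have [T TB] := orthonormal_basis.
(* S is the inverse of T: it takes a tangent vector at the unit to its coordinates in the
   orthonormal basis. *)
pose S := gram *m T^T.
have ST : S *m T = 1%:M by apply: mulmx1C; rewrite mulmxA.
pose fr u := lifield L (u *m T).
pose br u v := lbracket L (u *m T) (v *m T) *m S.
have brT u v : br u v *m T = lbracket L (u *m T) (v *m T).
  by rewrite /br -mulmxA ST mulmx1.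
have lin (B : 'M[R]_n) k (x y : 'rV[R]_n) :
    (k *: x + y) *m B = k *: (x *m B) + y *m B by rewrite mulmxDl -scalemxAl.
have [||Gam [Gskew GE]] := @koszul_connection R n br.
- move=> k x y z; apply: etrans _ (lin S k _ _).
  apply: etrans (congr1 (fun a => lbracket L a _ *m S) (lin T k x y)) _.
  exact: (congr1 (fun a => a *m S) (lbracket_linearl L k _ _ _)).
- move=> x y; apply: etrans (congr1 (fun a => a *m S) (lbracketC L _ _)) _.
  exact: mulNmx.
have lieE x y z : lie Gam x (lie Gam y z) =
    lbracket L (x *m T) (lbracket L (y *m T) (z *m T)) *m S.
  apply: etrans (GE _ _) (congr1 (fun a => lbracket L (x *m T) a *m S) _).
  exact: etrans (congr1 (fun a => a *m T) (GE y z)) (brT y z).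
exists Gam, fr; split; first exact: Gskew.
- move=> x y z.
  apply: etrans (congr2 +%R (congr2 +%R (lieE x y z) (lieE y z x)) (lieE z x y))
    _.
  rewrite -!mulmxDl; apply: etrans (congr1 (fun a => a *m S) _) (mul0mx _ _).
  exact: lbracket_jacobi.
- move=> u v; apply: etrans (bracket_lifield L _ _) _.
  exact: (congr1 (lifield L) (esym (etrans (congr1 (fun a => a *m T) (GE u v))
    (brT u v)))).
- split=> [p k u v|p u v].
    have e1 := congr1 (fun a => lifield L a p) (lin T k u v).
    have e2 := lifield_linear L k (u *m T) (v *m T) p.
    have e3 := etrans e1 e2.
    exact: e3.
  apply: etrans (lifield_metric p _ _) _; apply: etrans (esym (gramE _ _)) _.
  by rewrite trmx_mul !mulmxA -(mulmxA u) -(mulmxA u) TB mulmx1.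
- split=> [u|X LX]; first exact: lifield_lie.
  exists (X 1%g *m S); apply: etrans (lie_algebraE LX) _.
  by apply: (congr1 (lifield L)); rewrite -mulmxA ST mulmx1.
Qed.

End InvariantFrame.

Theorem proposition3p1 (R : realType) (n : nat) (G : groupTopologicalType)
    (L : lie_group R n G) (g : riemannian_metric L)
    (G_connected : connected [set: G])
    (G_simply_connected : simply_connected R G)
    (g_left_invariant : left_invariant_metric g) :
  reducible_holonomy g <->
  exists g1 g2 : set (vfield R n G),
    [/\ lie_subalgebra L g1 /\ lie_subalgebra L g2,
        orthogonal_decomposition g g1 g2,
        nonzero g1 /\ nonzero g2 &
        forall x1 x2, g1 x1 -> g2 x2 ->
          lie_inner g (bracket L x1 x2) x2 = 0 /\
          lie_inner g (bracket L x1 x2) x1 = 0].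
Proof.
have [Gam [fr [Gskew jac fr_bracket [frl frg] [frL frX]]]] :=
  invariant_frame g_left_invariant.
have frs u : smooth_vfield L (fr u) by have [] := frL u.
have fr_lin a u v : fr (a *: u + v) = a *: fr u + fr v.
  by apply/funext => p; exact: frl.
have fr_inj u v : fr u = fr v -> u = v.
  move=> uv; apply: dot_inj => w; rewrite -!(frg 1%g).
  exact: (congr1 (fun X : vfield R n G => g 1%g (X 1%g) (fr w 1%g)) uv).
have fr_0 : fr 0 = 0.
  by apply/funext => p; exact: (fr0 frl).
have inner u v : lie_inner g (fr u) (fr v) = dot u v by exact: frg.
split=> [[nabla [k [D [LC distD kn parD]]]]|[g1 [g2 [[sub1 sub2] [dec orth] [nz1
  nz2] cond]]]].
  have [W [rW WG]] := parallel_invariant_subspace Gskew frl frg frs fr_bracket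
    LC distD parD 1%g kn jac.
  pose Q1 (u : 'rV[R]_n) : Prop := (u <= W)%MS.
  pose Q2 (u : 'rV[R]_n) := u *m W^T = 0.
  have orthQ u v : Q1 u -> Q2 v -> dot u v = 0.
    move=> /submxP[c ->] v0.
    by rewrite dotC /dot trmx_mul mulmxA v0 mul0mx mxE.
  have Q1l u v : Q1 u -> Q1 (u *m Gam v).
    by move=> Qu; exact: submx_trans (submxMr _ Qu) (WG v).
  (* W is stable under the skew [Gam v], so its orthogonal is stable as well. *)
  have Q2l u v : Q2 u -> Q2 (u *m Gam v).
    move=> Qu; rewrite /Q2 -[Gam v]trmxK Gskew linearN/= mulmxN mulNmx -mulmxA.
    have /submxP[c cE] := WG v.
    by rewrite -trmx_mul cE trmx_mul mulmxA Qu mul0mx oppr0.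
  have subalgebra Q : Q 0 -> (forall a u v, Q u -> Q v -> Q (a *: u + v)) ->
      (forall u v, Q u -> Q (u *m Gam v)) ->
      lie_subalgebra L [set X | exists2 u, Q u & X = fr u].
    move=> Q0 Qlin QG; split.
    - by move=> _ [u _ ->].
    - by exists 0.
    - move=> a _ _ [u Qu ->] [v Qv ->]; exists (a *: u + v) => //; exact: Qlin.
    - move=> _ _ [u Qu ->] [v Qv ->]; exists (lie Gam u v) => //.
      rewrite /lie addrC -scaleN1r; apply: Qlin; exact: QG.
  exists [set X | exists2 u, Q1 u & X = fr u], [set X | exists2 u,
    Q2 u & X = fr u].
  have [P [Ps PP PW]] : exists P : 'M[R]_n, [/\ P^T = P, P *m P = P &
      forall v, Q1 v <-> v *m P = v].
    have [_ Ps PP PW] := orthogonal_projection (row_base_free W).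
    eexists; split; [exact: Ps|exact: PP|move=> v].
    by rewrite /Q1 -(eq_row_base W); exact: PW.
  have Q2P v : Q2 (v - v *m P).
    rewrite /Q2; have -> : W^T = P *m W^T.
      apply: trmx_inj; rewrite trmx_mul trmxK Ps; apply/row_matrixP => i.
      by rewrite row_mul; apply/esym/PW; exact: row_sub.
    by rewrite mulmxBl !mulmxA -(mulmxA v P P) PP subrr.
  split.
  - split; apply: subalgebra => //.
    + exact: sub0mx.
    + by move=> a u v Qu Qv; apply: addmx_sub Qv; exact: scalemx_sub.
    + exact: mul0mx.
    + by move=> a u v Qu Qv; rewrite /Q2 mulmxDl -scalemxAl Qu Qv scaler0 addr0.
  - split=> [X /frX[u ->]|_ _ [u Qu ->] [v Qv ->]]; last by rewrite inner orthQ.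
    exists (fr (u *m P)), (fr (u - u *m P)); split.
    + by exists (u *m P) => //; apply/PW; rewrite -mulmxA PP.
    + by exists (u - u *m P).
    + by rewrite -[fr (u *m P)]scale1r -fr_lin scale1r subrKC.
  - move/andP: rW => [r0 rn]; split.
      have /rowV0Pn[v vW v0] : W != 0 by rewrite -mxrank_eq0 -lt0n.
      exists (fr v); first by exists v.
      by apply: contra_neq v0 => v0; apply: fr_inj; rewrite v0 fr_0.
    have /rowV0Pn[v /sub_kermxP vW v0] : kermx W^T != 0.
      by rewrite -mxrank_eq0 mxrank_ker mxrank_tr subn_eq0 -ltnNge.
    exists (fr v); first by exists v.
    by apply: contra_neq v0 => v0; apply: fr_inj; rewrite v0 fr_0.
  (* In [dot (lie u v) v], one term vanishes by skewness and the other by the stability of Q1; for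
     [dot (lie u v) u], the stability of Q2 is used instead. *)
  - move=> _ _ [u Qu ->] [v Qv ->]; rewrite fr_bracket !inner !dot_lie.
    rewrite !dot_skew_self// !(subr0, sub0r) (orthQ _ _ (Q1l _ v Qu) Qv).
    by rewrite [dot (v *m _) u]dotC (orthQ _ _ Qu (Q2l _ u Qv)) oppr0.
(* In frame coordinates a subalgebra is closed under linear combinations, hence is a row space,
   whose rank can be compared with n. *)
have LQ (h : set (vfield R n G)) : lie_subalgebra L h ->
    exists W : 'M[R]_n, forall u, h (fr u) <-> (u <= W)%MS.
  move=> [_ h0 hlin _]; apply: (subspace_mx (Q := fun u => h (fr u))).
    by rewrite fr_0.
  by move=> a u v hu hv; rewrite fr_lin; exact: hlin.
have subD (h : set (vfield R n G)) u v : lie_subalgebra L h ->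
    h (fr u) -> h (fr v) -> h (fr (u + v)).
  move=> [_ _ hlin _] hu hv; have := hlin 1 _ _ hu hv.
  by rewrite -fr_lin scale1r.
have subL (h : set (vfield R n G)) u v : lie_subalgebra L h ->
    h (fr u) -> h (fr v) -> h (fr (lie Gam u v)).
  by move=> [_ _ _ hbr] hu hv; have := hbr _ _ hu hv; rewrite fr_bracket.
have [W WE] := LQ _ sub1.
have inv x y : g1 (fr y) -> g1 (fr (y *m Gam x)).
  apply: (orthogonal_subalgebras_invariant Gskew (Q1 := fun u => g1 (fr u))
    (Q2 := fun u => g2 (fr u))).
  - by move=> u v; exact: subD sub1.
  - by move=> u v; exact: subD sub2.
  - by move=> u v; exact: subL sub1.
  - by move=> u v; exact: subL sub2.
  - move=> u; have [X1 [X2 [h1 h2 uE]]] := dec _ (frL u).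
    have [L1 _ _ _] := sub1; have [L2 _ _ _] := sub2.
    have [v vE] := frX _ (L1 _ h1); have [w wE] := frX _ (L2 _ h2).
    exists v, w; split; [by rewrite -vE|by rewrite -wE|].
    by apply: fr_inj; rewrite uE vE wE -[fr v]scale1r -fr_lin scale1r.
  - by move=> u v hu hv; rewrite -inner; exact: orth.
  - by move=> u v hu hv; rewrite -!inner -fr_bracket; exact: cond.
have nz (h : set (vfield R n G)) : lie_subalgebra L h -> nonzero h ->
    exists2 u, h (fr u) & u != 0.
  move=> [hL _ _ _] [X hX X0]; have [u uE] := frX _ (hL _ hX).
  by exists u; [rewrite -uE|apply: contra_neq X0 => u0; rewrite uE u0 fr_0].
apply: (invariant_subspace_parallel Gskew frl frg frs fr_bracket (W := W)).
  apply/andP; split.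
    have [u /WE uW] := nz _ sub1 nz1; apply: contraR;
      rewrite -eqn0Ngt mxrank_eq0.
    by move=> /eqP W0; move: uW; rewrite W0 submx0.
  (* If W were everything, a nonzero element of g2 would also lie in g1, hence be orthogonal to
     itself. *)
  rewrite ltnNge; apply/negP => rn; have [u hu /eqP] := nz _ sub2 nz2; apply.
  apply: dot_eq0; rewrite -inner; apply: orth hu; apply/WE/submx_full.
  by rewrite /row_full eqn_leq rank_leq_col rn.
by move=> x; apply/row_subP => i; rewrite row_mul; apply/WE/inv/WE/row_sub.
Qed.
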